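(* Let $\mathcal A=\{A_1,\dots,A_m\}$ be an irreducible finite family of real $d\times d$ matrices that possesses a unique dominant product $\Pi$ whose leading eigenvalue is unique and simple, non-real, and has a rational $\mathrm{mod}\ \pi$ argument. Then every invariant body of $\mathcal A$ is constructed by Algorithm 3 (described in the context) with some admissible subset $V_1$ of the leading plane of $\Pi$.
   Context: Family: $\mathcal A$ is irreducible if the matrices $A_i$ share no common invariant linear subspace other than $\{0\}$ and $\mathbb R^d$. $\mathcal A^n$ is the set of all products of $n$ matrices from $\mathcal A$ (repetitions permitted), $\mathcal A^{\mathbb N}=\bigcup_{n\ge1}\mathcal A^n$; products are regarded as words, $|\Pi|$ is the length of $\Pi$. $\rho(S)$ is the spectral radius of a matrix; $\rho(\mathcal A)=\lim_{n\to\infty}\max_{\Pi\in\mathcal A^n}\|\Pi\|^{1/n}$ is the joint spectral radius; $\nu(\Pi)=\rho(\Pi)^{1/|\Pi|}$. A convex body is a convex compact set with nonempty interior, assumed symmetric about the origin. A convex body $G$ is invariant for $\mathcal A$ if $\mathrm{co}\bigl(\bigcup_iA_iG\bigr)=\rho(\mathcal A)\,G$. A product is primitive if it is not a power of a shorter product. A set $\mathcal P\subset\mathcal A^{\mathbb N}$ is a set of dominant products if: (1) all its elements are primitive and none is a cyclic permutation of another; (2) there is $q$ with $\nu(\Pi)=q$ for all $\Pi\in\mathcal P$; (3) there is $\varepsilon>0$ such that every $S\in\mathcal A^{\mathbb N}$ satisfies $\nu(S)\le(1-\varepsilon)^{1/|S|}q$ unless $S$ is a power of some product from $\mathcal P$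 or of one of its cyclic permutations. $\mathcal A$ has a unique dominant product $\Pi$ if $\mathcal P=\{\Pi\}$ is a set of dominant products. A leading eigenvalue is an eigenvalue of largest modulus; it is unique and simple if it is not multiple and all other eigenvalues, except for $\bar\lambda$ when $\lambda\notin\mathbb R$, are strictly smaller in modulus. For $\lambda=|\lambda|e^{i\varphi}$ the argument is rational $\mathrm{mod}\ \pi$ if $\varphi/\pi\in\mathbb Q$. For a non-real leading eigenvalue $\lambda$ with eigenvector $x+iy$ ($x,y\in\mathbb R^d$), the leading plane (leading eigenspace) is the real span of $x,y$. A convex compact subset $V$ of the leading plane of $\Pi$ is admissible if $V\ne\{0\}$, $V=-V$ and $\Pi V=|\lambda|V$. Algorithm 3. Input: the product $\Pi=A_{s_n}\cdots A_{s_1}$ and an admissible set $V_1$. Put $\tilde A_j=\nu(\Pi)^{-1}A_j$, $\tilde{\mathcal A}=\{\tilde A_1,\dots,\tilde A_m\}$, $\tilde\Pi=\tilde A_{s_n}\cdots\tilde A_{s_1}$ (so $\tilde\Pi V_1=V_1$), $V_j=\tilde A_{s_{j-1}}\cdots\tilde A_{s_1}V_1$ for $j=2,\dots,n$, and let $\tilde\Pi_j=\tilde A_{s_{j-1}}\cdots\tilde A_{s_1}\tilde A_{s_n}\cdots\tilde A_{s_j}$ (with $\tilde\Pi_1=\tilde\Pi$) be the $j$th cyclic permutation, so that $\tilde\Pi_jV_j=V_j$; its first (rightmost, first applied) matrix is $\tilde A_{s_j}$. The root is $\mathcal R=\{V_1,\dots,V_n\}$. Every node $V$ is either an element $V_j$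 of the root or the end of a finite path, i.e. the image of some root element $V_j$ under a finite product of matrices from $\tilde{\mathcal A}$ whose first applied matrix is not $\tilde A_{s_j}$; such a $V$ is said to originate at $V_j$. For such $V$, $\pi_j^\infty(V)$ denotes the infinite path of nodes obtained from $V$ by applying successively the matrices $\tilde A_{s_j},\tilde A_{s_{j+1}},\dots$ (indices of $s$ taken cyclically modulo $n$), i.e. by repeating periodically the word of $\tilde\Pi_j$. Zero iteration: $\mathcal V_0=\mathcal H_0=\mathcal R$. $k$th iteration, $k\ge1$: start with $\mathcal V_k=\mathcal V_{k-1}$, $\mathcal H_k=\emptyset$. For every node $V\in\mathcal H_{k-1}$, originating at $V_j$: (a) for every $\tilde A\in\tilde{\mathcal A}$ different from the first matrix $\tilde A_{s_j}$ of $\tilde\Pi_j$, if $\tilde AV$ lies in the interior of $G_{k-1}$ it is omitted, otherwise $\tilde AV$ is added to $\mathcal V_k$ and $\mathcal H_k$; (b) if $k\ge2$, the infinite path $\pi_j^\infty(V)$ is considered: if some of its nodes lies in the interior of the current body $G_k$ (generated by the sets currently in $\mathcal V_k$), then the first such node $V'$ and everything after it on the path is removed, and all nodes of the path preceding $V'$ are added to $\mathcal V_k$ and $\mathcal H_k$; if there is no such node, all nodes of the path are added to $\mathcal V_k$ and $\mathcal H_k$. (When $k=1$, step (b) is omitted since for $V=V_j$ the path runs over the root.) At the end of the iteration, $G_k$ is the closed convex hull of the union of all sets in $\mathcal V_k$ (and $G_0$ is that of $\mathcal V_0$). Termination: the algorithm halts when $\mathcal V_k=\mathcal V_{k-1}$,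 i.e. $\mathcal H_k=\emptyset$; then $G_k$ is the body constructed by the algorithm. *)

(* Defs.v *)
From mathcomp Require Export all_boot all_order all_algebra.
From mathcomp Require Export complex.
From mathcomp Require Export all_classical all_reals all_analysis.

Set Implicit Arguments.
Unset Strict Implicit.
Unset Printing Implicit Defensive.

Export Order.TTheory GRing.Theory Num.Theory.
Export numFieldNormedType.Exports.
Local Open Scope classical_set_scope.
Local Open Scope ring_scope.

Definition cmod (R : realType) (z : R[i]) : R := ComplexField.Normc.normc z.

Section Spectrum.
Variables (R : realType) (d : nat).
Implicit Types (M : 'M[R]_d) (z w : R[i]).

Definition complexify M : 'M[R[i]]_d := map_mx (real_complex R) M.

(* The library's eigenvalues are those of the action on row vectors; they are
   the roots of the characteristic polynomial, so the sidedness is immaterial. *)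
Definition spectral_radius M : R :=
  sup [set cmod z | z in [set z | eigenvalue (complexify M) z]].

Definition leading_eigenvalue M z : Prop :=
  eigenvalue (complexify M) z /\
  forall w, eigenvalue (complexify M) w -> cmod w <= cmod z.

Definition unique_simple_leading_eigenvalue M z : Prop :=
  [/\ leading_eigenvalue M z,
      mup z (char_poly (complexify M)) = 1%N &
      forall w, eigenvalue (complexify M) w -> w <> z ->
        ~ (complex.Im z != 0 /\ w = conjc z) -> cmod w < cmod z].

Definition rational_arg z : Prop :=
  exists (phi : R) (q : rat),
    z = Complex (cmod z * cos phi) (cmod z * sin phi) /\ phi / pi = ratr q.

Definition leading_plane M z (L : {vspace 'cV[R]_d}) : Prop :=
  exists x y : 'cV[R]_d,
    let v := map_mx (real_complex R) x + Complex 0 1 *: map_mx (real_complex R) y in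
    [/\ v != 0, complexify M *m v = z *: v & L = <<[:: x; y]>>%VS].

(* Nonemptiness is what "convex compact set" tacitly includes. *)
Definition admissible M z (V : set 'cV[R]_d) : Prop :=
  (exists L, leading_plane M z L /\ V `<=` [set v | v \in L]) /\
  [/\ V !=set0, V <> [set 0], convex_set V & compact V] /\
  [/\ V = [set - v | v in V] &
      [set M *m v | v in V] = [set cmod z *: v | v in V]].

End Spectrum.

Section Families.
Variables (R : realType) (d m : nat).
Implicit Types (A : 'I_m -> 'M[R]_d) (w u p : seq 'I_m) (P : set (seq 'I_m)).

Definition irreducible_family A : Prop :=
  forall U : {vspace 'cV[R]_d},
    (forall i v, v \in U -> A i *m v \in U) -> U = 0%VS \/ U = fullv.

(* Words list the indices in the order in which the matrices are applied:
   [:: s1; ...; sn] stands for the product A_sn ... A_s1. *)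
Definition word_prod A w : 'M[R]_d := foldl (fun B i => A i *m B) 1%:M w.

(* The limit does not depend on the matrix norm; `|_| is the largest modulus
   of an entry. *)
Definition joint_spectral_radius A : R :=
  limn (fun n => (\big[Num.max/0]_(w : n.-tuple 'I_m) `|word_prod A w|)
                 `^ (n%:R^-1)).

Definition nu A w : R := spectral_radius (word_prod A w) `^ ((size w)%:R^-1).

Definition wpow w (k : nat) : seq 'I_m := flatten (nseq k w).

Definition cyclic_permutation w u : Prop := exists r, w = rot r u.

Definition primitive_word w : Prop :=
  forall u k, (size u < size w)%N -> w <> wpow u k.

(* The bound e < 1 keeps the base of the real power positive: the library sets
   x `^ r = 1 for x < 0 and r != 0. *)
Definition dominant_set A P : Prop :=
  [/\ forall p, P p -> p <> [::],
      forall p, P p -> primitive_word p,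
      forall p u, P p -> P u -> p <> u -> ~ cyclic_permutation p u &
      exists q : R, (forall p, P p -> nu A p = q) /\
        exists e : R, 0 < e < 1 /\
          forall w, w <> [::] ->
            nu A w <= (1 - e) `^ ((size w)%:R^-1) * q \/
            exists p u k, [/\ P p, cyclic_permutation u p & w = wpow u k]].

Definition unique_dominant_product A w : Prop := dominant_set A [set w].

End Families.

Section Bodies.
Variables (R : realType) (d : nat).
Implicit Types X G : set 'cV[R]_d.

Definition convex_hull X : set 'cV[R]_d := smallest (@convex_set R 'cV[R]_d) X.

Definition closed_convex_hull X : set 'cV[R]_d := closure (convex_hull X).

Definition symmetric_convex_body G : Prop :=
  [/\ convex_set G, compact G, G° !=set0 & G = [set - x | x in G]].

Definition invariant_body (m : nat) (A : 'I_m -> 'M[R]_d) G : Prop :=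
  symmetric_convex_body G /\
  convex_hull (\bigcup_i [set A i *m x | x in G]) =
    [set joint_spectral_radius A *: x | x in G].

End Bodies.

Section Algorithm3.
Variables (R : realType) (d m : nat) (A : 'I_m -> 'M[R]_d) (s : seq 'I_m).
Variable V1 : set 'cV[R]_d.

Definition normalized (i : 'I_m) : 'M[R]_d := (nu A s)^-1 *: A i.

(* The node (j, w) originates at the root element number j (counted from 0) and
   is its image under the product w; root elements have w = [::].  Nodes are
   thus identified with paths of the tree rather than with subsets of R^d. *)
Definition node : Type := ('I_(size s) * seq 'I_m)%type.
Implicit Types (V H : set node) (v : node) (G : set 'cV[R]_d).

Definition root_set : set node := [set v | v.2 = [::]].

Definition node_set v : set 'cV[R]_d :=
  [set word_prod normalized (take v.1 s ++ v.2) *m x | x in V1].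

Definition body V : set 'cV[R]_d :=
  closed_convex_hull (\bigcup_(v in V) node_set v).

Definition extend v w : node := (v.1, v.2 ++ w).

(* First t letters of the periodic word generated by the cyclic permutation of
   s that starts at position v.1. *)
Definition path_node v (t : nat) : node :=
  extend v (take t (wpow (rot v.1 s) t)).

(* Letters are compared instead of matrices: for a unique dominant product s no
   letter of s can denote the same matrix as another index. *)
Definition step_a G v : set node :=
  [set u | exists a : 'I_m,
     [/\ a <> tnth (in_tuple s) v.1, u = extend v [:: a] &
         ~ (node_set u `<=` G°)]].

(* The path starts with the first image of v, so t = 0 (the node v itself) is
   neither tested nor added. *)
Definition step_b G v : set node :=
  [set u | exists t : nat, [/\ (0 < t)%N, u = path_node v t &
     forall t', (0 < t' <= t)%N -> ~ (node_set (path_node v t') `<=` G°)]].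

(* Treatment of the node v in the k-th iteration, which started from V, when
   the current collection of nodes is C. *)
Definition process (k : nat) V v (C : set node) : set node :=
  let Ca := C `|` step_a (body V) v in
  if (1 < k)%N then Ca `|` step_b (body Ca) v else Ca.

(* Nodes collected after the first i entries of the enumeration e have been
   inspected; entries outside H are skipped. *)
Fixpoint sweep (k : nat) V H (e : nat -> node) (i : nat) : set node :=
  if i is i'.+1 then
    let C := sweep k V H e i' in
    if `[< H (e i') >] then process k V (e i') C else C
  else V.

(* The pair (V_k, H_k); e k is the order in which the k-th iteration runs
   through the (possibly infinite) collection H_(k-1).  A node already present
   is not added again, so H_k is made of the new nodes. *)
Fixpoint state (e : nat -> nat -> node) (k : nat) : set node * set node :=
  if k is k'.+1 then
    let: (V, H) := state e k' in
    let V' := \bigcup_i sweep k V H (e k) i in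
    (V', V' `\` V)
  else (root_set, root_set).

Definition halts_at (e : nat -> nat -> node) (k : nat) : Prop :=
  (0 < k)%N /\ (state e k).1 = (state e k.-1).1.

Definition constructed_by_algorithm3 (G : set 'cV[R]_d) : Prop :=
  forall e : nat -> nat -> node, (forall k, bijective (e k)) ->
    exists k, halts_at e k /\ body (state e k).1 = G.

End Algorithm3.

(* Main.v *)
(* Let [B_i = A_i / nu(s)] and let [V1] be the part of [G] in the leading plane.

   If the points [x] and [B_w x] are close and [x] is not interior to [G], then
   [1 - B_w] is nearly singular, so that by dominance [w] is a power of a cyclic
   permutation of [s]. An extreme point of [G] has a backward orbit of extreme
   points; by compactness the orbit keeps coming back close to one of its points,
   so it is eventually periodic along [s] and that point lies in some [V_j]: all
   components off the leading plane are contracted. (Run with [A_i / rho] this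
   also shows [rho = nu(s)], whatever the limit defining [rho].) Hence every
   extreme point of [G] belongs to a node.

   Call a node boundary if it meets the boundary of [G]. The bodies [G_k] are
   contained in [G], so boundary nodes are never omitted. By the first remark and
   the pigeonhole principle, the word of a boundary node is a concatenation of a
   bounded number of pieces of the periodic word of [s], and each of these is
   explored in boundedly many iterations. So all boundary nodes are present after
   a fixed number [T] of iterations; then [G_T = G], and from then on only
   boundary nodes could be added, so that the algorithm halts. *)

Require Import Defs.
From mathcomp Require Import perm ring lra zify.

Set Implicit Arguments.
Unset Strict Implicit.
Unset Printing Implicit Defensive.

Local Open Scope classical_set_scope.
Local Open Scope ring_scope.

(** * Norms and convex bodies *)

Section MatrixNorm.
Variable R : realType.

Lemma norm_coord_le m n (A : 'M[R]_(m, n)) i j : `|A i j| <= `|A|.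
Proof.
rewrite [leRHS]/Num.norm /= mx_normrE.
by apply/bigmax_geP; right => /=; exists (i, j).
Qed.

Lemma mx_norm_le m n (A : 'M[R]_(m, n)) (c : R) :
  0 <= c -> (forall i j, `|A i j| <= c) -> `|A| <= c.
Proof.
move=> c0 Ac; rewrite [leLHS]/Num.norm /= mx_normrE.
by apply/bigmax_leP; split => // -[i j] _; exact: Ac.
Qed.

Lemma norm_mulmx_le m n p (A : 'M[R]_(m, n)) (B : 'M[R]_(n, p)) :
  `|A *m B| <= n%:R * `|A| * `|B|.
Proof.
apply: mx_norm_le => [|i j]; first by rewrite !mulr_ge0.
rewrite mxE (le_trans (ler_norm_sum _ _ _))//.
rewrite -mulrA mulr_natl -[X in _ *+ X]card_ord -sumr_const.
by apply: ler_sum => k _; rewrite normrM ler_pM// norm_coord_le.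
Qed.

Lemma mulmx_continuous m n (A : 'M[R]_(m, n)) :
  continuous (fun x : 'cV[R]_n => A *m x).
Proof.
move=> x B /nbhs_ballP[e /= e0 eB].
have k0 : 0 < n%:R * `|A| + 1 :> R by rewrite ltr_wpDl// mulr_ge0.
apply/nbhs_ballP; exists (e / (n%:R * `|A| + 1)) => /=; first by rewrite divr_gt0.
move=> y; rewrite -ball_normE /= => xy.
apply: eB; rewrite -ball_normE /= -mulmxBr (le_lt_trans (norm_mulmx_le _ _))//.
apply: (@le_lt_trans _ _ ((n%:R * `|A| + 1) * `|x - y|)).
  by rewrite ler_wpM2r// lerDl.
by rewrite mulrC -ltr_pdivlMr.
Qed.

Lemma closed_mulmx_fibre m n (A : 'M[R]_(m, n)) (b : 'cV[R]_m) :
  closed [set x : 'cV[R]_n | A *m x = b].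
Proof.
rewrite (_ : [set x | _] = (fun x => A *m x) @^-1` [set b]) //.
apply: closed_comp; first by move=> ? _; exact: mulmx_continuous.
exact: (accessible_closed_set1 (hausdorff_accessible (@norm_hausdorff _ _))).
Qed.

End MatrixNorm.

Section ConvexSets.
Variables (R : realType) (d : nat).
Implicit Types (G X K : set 'cV[R]_d) (x y : 'cV[R]_d) (t c : R).

Lemma convex_setP G : convex_set G <->
  forall x y t, G x -> G y -> 0 <= t <= 1 -> G (t *: x + (1 - t) *: y).
Proof.
split=> [cG x y t Gx Gy t01|cG x y l].
  by have := cG x y (Itv01 (andP t01).1 (andP t01).2); rewrite !inE; apply.
rewrite !inE => Gx Gy; apply: cG => //.
by apply/andP; split; [exact: ge0|exact: le1].
Qed.

Lemma subset_convex_hull X : X `<=` convex_hull X.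
Proof. exact: sub_smallest. Qed.

Lemma convex_hull_min X G : convex_set G -> X `<=` G -> convex_hull X `<=` G.
Proof. by move=> cG XG; apply: smallest_sub. Qed.

Lemma convex_hull_convex X : convex_set (convex_hull X).
Proof.
apply/convex_setP => x y t Hx Hy t01 C [cC XC].
by move/convex_setP : (cC); apply => //; [exact: Hx|exact: Hy].
Qed.

Lemma closure_convex G : convex_set G -> convex_set (closure G).
Proof.
move=> /convex_setP cG; apply/convex_setP => x y t clx cly /andP[t0 t1].
move=> B /nbhs_ballP[e /= e0 eB].
have [x' [Gx' xx']] := clx _ (nbhsx_ballx x e e0).
have [y' [Gy' yy']] := cly _ (nbhsx_ballx y e e0).
exists (t *: x' + (1 - t) *: y'); split; first by apply: cG; rewrite ?t0.
apply: eB; move: xx' yy'; rewrite -!ball_normE /= => xx' yy'.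
have -> : t *: x + (1 - t) *: y - (t *: x' + (1 - t) *: y') =
  t *: (x - x') + (1 - t) *: (y - y').
  by apply/matrixP => i j; rewrite !mxE; ring.
rewrite (le_lt_trans (ler_normD _ _))// !normrZ ger0_norm// ger0_norm ?subr_ge0//.
have [t00|t00] := eqVneq t 0; first by rewrite t00 mul0r add0r subr0 mul1r.
have tpos : 0 < t by rewrite lt_def t00.
have : t * `|x - x'| < t * e by rewrite ltr_pM2l.
have : (1 - t) * `|y - y'| <= (1 - t) * e.
  by rewrite ler_wpM2l ?subr_ge0// ltW.
by move=> ? ?; lra.
Qed.

Lemma closed_convex_hull_min X G :
  convex_set G -> closed G -> X `<=` G -> closed_convex_hull X `<=` G.
Proof.
move=> cG clG XG; rewrite /closed_convex_hull.
have /closure_id-> := clG.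
by apply: closure_subset; exact: convex_hull_min.
Qed.

Lemma subset_closed_convex_hull X : X `<=` closed_convex_hull X.
Proof.
exact: subset_trans (@subset_convex_hull X) (@subset_closure _ _).
Qed.

Lemma closed_convex_hull_convex X : convex_set (closed_convex_hull X).
Proof. exact/closure_convex/convex_hull_convex. Qed.

End ConvexSets.

Section SymmetricBody.
Variables (R : realType) (d : nat) (G : set 'cV[R]_d).
Implicit Types (x y : 'cV[R]_d) (t c : R).
Hypothesis bodyG : symmetric_convex_body G.

Lemma body_convex x y t : G x -> G y -> 0 <= t <= 1 -> G (t *: x + (1 - t) *: y).
Proof. by have [/convex_setP cG _ _ _] := bodyG; exact: cG. Qed.

Lemma body_opp x : G x -> G (- x).
Proof. by move=> Gx; have [_ _ _ ->] := bodyG; exists x. Qed.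

Lemma body_compact : compact G. Proof. by have [] := bodyG. Qed.

Lemma body_closed : closed G.
Proof. exact: compact_closed (@norm_hausdorff _ _) body_compact. Qed.

(** By symmetry: if a ball around [x] lies in [G], then a small [y] is the midpoint of [x + 2 *: y]
    and [- x], both in [G]. *)
Lemma body_ball : exists2 r : R, 0 < r & forall x, `|x| < r -> G x.
Proof.
have [_ _ [x]] := bodyG; rewrite /interior => /nbhs_ballP[e /= e0 eG] _.
exists (e / 2); first by rewrite divr_gt0.
move=> y ye.
have Gx : G x by apply: eG; exact: ballxx.
have -> : y = (1 / 2) *: (x + 2 *: y) + (1 - 1 / 2) *: - x.
  by apply/matrixP => i j; rewrite !mxE; field.
apply: body_convex; last by lra.
  apply: eG; rewrite -ball_normE /= opprD addNKr normrN normrZ ger0_norm//; lra.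
exact: body_opp.
Qed.

Lemma body0 : G 0.
Proof. by have [r r0] := body_ball; apply; rewrite normr0. Qed.

Lemma body_bounded : exists2 C : R, 0 < C & forall x, G x -> `|x| <= C.
Proof.
have [C C0 GC] : exists2 C : R, 0 < C & forall x, x \in G -> `|x| < C.
  have /ex_strict_bound_gt0 [C C0 HC] := compact_bounded body_compact.
  by exists C => // x; rewrite inE => /HC.
by exists C => // x Gx; rewrite ltW// GC// inE.
Qed.

(** The gauge description of the interior. It is compatible with every linear map that preserves
    [G], even a singular one, which need not map open sets to open sets. *)
Lemma body_interiorP x : G° x <-> exists2 c, 1 < c & G (c *: x).
Proof.
split; last first.
  move=> [c c1 Gcx]; have [r r0 rG] := body_ball.
  have c0 : 0 < c by lra.
  apply/nbhs_ballP; exists ((1 - c^-1) * r) => /=.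
    by rewrite mulr_gt0// subr_gt0 invf_lt1.
  move=> y; rewrite -ball_normE /= => xy.
  have e0 : 0 < 1 - c^-1 by rewrite subr_gt0 invf_lt1.
  (* [y] is a convex combination of [c *: x] and a point of the small ball inside [G]. *)
  have -> : y = c^-1 *: (c *: x) + (1 - c^-1) *: ((1 - c^-1)^-1 *: (y - x)).
    by rewrite !scalerA mulVf ?gt_eqF// divff ?gt_eqF// !scale1r addrC subrK.
  apply: body_convex => //.
    apply: rG; rewrite normrZ ger0_norm ?invr_ge0 ?ltW//.
    by rewrite ltr_pdivrMl// distrC.
  by rewrite invr_ge0 (ltW c0) invf_le1// ltW.
move=> /nbhs_ballP[e /= e0 eG].
have [->|x0] := eqVneq x 0.
  by exists 2; rewrite ?scaler0; [lra|exact: body0].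
have nx : 0 < `|x| by rewrite normr_gt0.
exists (1 + e / 2 / `|x|).
  by rewrite ltrDl !divr_gt0.
apply: eG; rewrite -ball_normE /= scalerDl scale1r opprD addNKr normrN normrZ.
rewrite ger0_norm; last by rewrite !divr_ge0// ltW.
by rewrite divfK ?gt_eqF//; lra.
Qed.

Lemma body_interior_mulmx (B : 'M[R]_d) x :
  (forall y, G y -> G (B *m y)) -> G° x -> G° (B *m x).
Proof.
move=> BG /body_interiorP[c c1 Gcx]; apply/body_interiorP; exists c => //.
by rewrite scalemxAr; exact: BG.
Qed.

Lemma body_norm_ge : exists2 r : R, 0 < r & forall x, ~ G° x -> r <= `|x|.
Proof.
have [r r0 rG] := body_ball; exists r => // x; apply: contra_notT.
rewrite -ltNge => xr; rewrite /interior.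
apply/nbhs_ballP; exists (r - `|x|) => /=; first by rewrite subr_gt0.
move=> y; rewrite -ball_normE /= => xy; apply: rG.
have -> : y = x - (x - y) by rewrite opprB addrC subrK.
by rewrite (le_lt_trans (ler_normB _ _))//; lra.
Qed.

End SymmetricBody.

(** * Extreme points and compactness *)

Section ExtremePoints.
Variables (R : realType) (d : nat).
Implicit Types (G X K : set 'cV[R]_d) (x y z u v : 'cV[R]_d) (t : R).

Definition extreme_point G x :=
  G x /\ forall y z t, G y -> G z -> 0 < t < 1 -> x = t *: y + (1 - t) *: z -> y = z.

(** Removing an extreme point from a convex set leaves a convex set; if [x] were not in [X], the
    hull without [x] would be a smaller convex set containing [X]. *)
Lemma extreme_convex_hull X x : extreme_point (convex_hull X) x -> X x.
Proof.
move=> [hx ext]; apply: contrapT => nXx.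
have cH := @convex_hull_convex _ _ X.
have cC : convex_set (convex_hull X `\ x).
  apply/convex_setP => y z t [hy yx] [hz zx] t01; split.
    by move/convex_setP : cH; apply.
  move=> /= e.
  have [t0|t0] := eqVneq t 0.
    by apply: zx; move: e; rewrite t0 scale0r add0r subr0 scale1r.
  have [t1|t1] := eqVneq t 1.
    by apply: yx; move: e; rewrite t1 subrr scale0r addr0 scale1r.
  have yz : y = z.
    apply: (ext y z t) => //; case/andP: t01 => a b.
    by rewrite !lt_def t0 a eq_sym t1 b.
  apply: yx; rewrite /= -e -yz -scalerDl addrC subrK scale1r; by [].
have XC : X `<=` convex_hull X `\ x.
  move=> y Xy; split; first exact: subset_convex_hull.
  by move=> /= yx; rewrite yx in Xy.
by have [_ /(_ erefl)] := convex_hull_min cC XC hx.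
Qed.

(** The Euclidean product serves here because the ambient norm is the maximum norm, which is not
    strictly convex. *)
Definition dot u v : R := \sum_i u i ord0 * v i ord0.
Definition sqn u : R := dot u u.

Lemma sqn_ge0 u : 0 <= sqn u.
Proof. by apply: sumr_ge0 => i _; rewrite -expr2 sqr_ge0. Qed.

Lemma sqn_eq0 u : sqn u = 0 -> u = 0.
Proof.
move/eqP; rewrite psumr_eq0; last by move=> i _; rewrite -expr2 sqr_ge0.
move=> /allP u0; apply/matrixP => i j; rewrite ord1 !mxE.
have := u0 i; rewrite mem_index_enum => /(_ isT).
by rewrite mulf_eq0 orbb => /eqP.
Qed.

Lemma sqn_gt0 u : u != 0 -> 0 < sqn u.
Proof.
by move=> u0; rewrite lt_def sqn_ge0 andbT; apply: contra u0 => /eqP/sqn_eq0->.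
Qed.

Lemma sqn_lincomb u v (a b : R) :
  sqn (a *: u + b *: v) = a ^+ 2 * sqn u + 2 * a * b * dot u v + b ^+ 2 * sqn v.
Proof.
rewrite /sqn /dot !mulr_sumr -!big_split /=; apply: eq_bigr => i _.
by rewrite !mxE; ring.
Qed.

Lemma sqn_conv u v t : sqn (t *: u + (1 - t) *: v) =
  t * sqn u + (1 - t) * sqn v - t * (1 - t) * sqn (u - v).
Proof.
have -> : u - v = 1 *: u + (-1) *: v by rewrite scale1r scaleN1r.
by rewrite !sqn_lincomb; ring.
Qed.

Lemma sqn_sub_continuous c : continuous (fun x => sqn (x - c)).
Proof.
rewrite /sqn /dot; apply: continuous_big; first exact: add_continuous.
move=> i _ x.
have cf : {for x, continuous (fun y : 'cV[R]_d => (y - c) i ord0)}.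
  rewrite (_ : (fun y : 'cV[R]_d => (y - c) i ord0) = (fun y => y i ord0 - c i ord0)).
    by apply: continuousB; [exact: coord_continuous|exact: cst_continuous].
  by apply/funext => y; rewrite !mxE.
exact: continuousM.
Qed.

(** By strict convexity of the Euclidean norm ([sqn_conv]), a proper convex combination of two
    distinct points is strictly closer to [c] than the farther of the two. *)
Lemma farthest_extreme G c : compact G -> G !=set0 ->
  exists2 y, extreme_point G y & forall x, G x -> sqn (x - c) <= sqn (y - c).
Proof.
move=> cG G0.
have [y yG ymax] := compact_EVT_max G0 cG (continuous_subspaceT (sqn_sub_continuous (c := c))).
have {}ymax x : G x -> sqn (x - c) <= sqn (y - c) by move=> Gx; apply: ymax; rewrite inE.
rewrite inE in yG; exists y => //; split => // a b t Ga Gb /andP[t0 t1] ye.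
have e : y - c = t *: (a - c) + (1 - t) *: (b - c).
  by rewrite ye; apply/matrixP => i j; rewrite !mxE; ring.
have := sqn_conv (a - c) (b - c) t; rewrite -e opprB addrA subrK => e2.
have ha := ymax _ Ga; have hb := ymax _ Gb.
have [/eqP|/sqn_gt0 pos] := eqVneq (a - b) 0; first by rewrite subr_eq0 => /eqP.
have t1' : 0 < 1 - t by lra.
have h1 := mulr_gt0 (mulr_gt0 t0 t1') pos.
have h2 : t * sqn (a - c) <= t * sqn (y - c) by rewrite ler_pM2l.
have h3 : (1 - t) * sqn (b - c) <= (1 - t) * sqn (y - c) by rewrite ler_pM2l.
exfalso; lra.
Qed.

(** The fibre of [B] over an extreme point is a face of [G], so an extreme point of this compact
    fibre is extreme in [G]. *)
Lemma extreme_preimage G (B : 'M[R]_d) x y0 :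
  compact G -> (forall y, G y -> G (B *m y)) -> extreme_point G x ->
  G y0 -> x = B *m y0 -> exists2 y, extreme_point G y & x = B *m y.
Proof.
move=> cG BG [Gx ext] Gy0 xy0.
have cH := compact_closedI cG (closed_mulmx_fibre (A := B) (b := x)).
have [|y [[Gy By] exty] _] := farthest_extreme 0 cH; first by exists y0; split.
exists y => //; split=> // a b t Ga Gb t01 yab.
have BaBb : B *m a = B *m b.
  apply: (ext _ _ t) => //; try exact: BG.
  by rewrite -By yab mulmxDr -!scalemxAr.
have Bax : B *m a = x.
  by rewrite -By yab mulmxDr -!scalemxAr -BaBb -scalerDl addrC subrK scale1r.
by apply: (exty a b t) => //; split=> //=; rewrite -?BaBb.
Qed.

(** A substitute for Krein-Milman: a hyperplane separating [x] from [K] is bent into a large sphere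
    that encloses [K] but not [x]; the point of [G] farthest from its centre is extreme and outside
    [K]. *)
Lemma extreme_outside G K x : compact G -> compact K -> convex_set K -> K !=set0 ->
  G x -> ~ K x -> exists2 y, extreme_point G y & ~ K y.
Proof.
move=> cG cK /convex_setP convK K0 Gx nKx.
have [p pK pmin] := compact_EVT_min K0 cK (continuous_subspaceT (sqn_sub_continuous (c := x))).
have {}pmin y : K y -> sqn (p - x) <= sqn (y - x) by move=> ?; apply: pmin; rewrite inE.
rewrite inE in pK.
pose h := x - p.
have h0 : 0 < sqn h.
  by apply: sqn_gt0; apply/eqP => /eqP; rewrite subr_eq0 => /eqP xp; rewrite xp in nKx.
(* The nearest point [p] satisfies the variational inequality; otherwise a step of length [t] from
   [p] towards [y] would come closer to [x]. *)
have var y : K y -> dot (y - p) h <= 0.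
  move=> Ky; rewrite leNgt; apply/negP => a0.
  have b0 := sqn_ge0 (y - p).
  pose t := dot (y - p) h / (dot (y - p) h + sqn (y - p)).
  have den : 0 < dot (y - p) h + sqn (y - p) by lra.
  have t0 : 0 < t by rewrite divr_gt0.
  have t1 : t <= 1 by rewrite ler_pdivrMr// mul1r lerDl.
  have := pmin _ (convK _ _ t Ky pK _); rewrite (ltW t0) t1 => /(_ isT).
  have -> : t *: y + (1 - t) *: p - x = t *: (y - p) + (-1) *: h.
    by apply/matrixP => i j; rewrite !mxE; ring.
  have -> : p - x = 0 *: (y - p) + (-1) *: h.
    by apply/matrixP => i j; rewrite !mxE; ring.
  rewrite !sqn_lincomb => hh.
  have tE : t * (dot (y - p) h + sqn (y - p)) = dot (y - p) h by rewrite divfK// gt_eqF.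
  have : t * (2 * dot (y - p) h) <= t * (t * sqn (y - p)) by lra.
  rewrite ler_pM2l// => h3.
  have := mulr_gt0 t0 a0; lra.
have [q qK qmax] := compact_EVT_max K0 cK (continuous_subspaceT (sqn_sub_continuous (c := p))).
have {}qmax y : K y -> sqn (y - p) <= sqn (q - p) by move=> ?; apply: qmax; rewrite inE.
have D0 := sqn_ge0 (q - p).
(* Seen from [p - l *: h], points of [K] have squared distance at most [(l + l ^+ 2) * sqn h], while
   [x] has [(1 + l) ^+ 2 * sqn h]. *)
pose l := sqn (q - p) / sqn h.
have l0 : 0 <= l by rewrite divr_ge0// ltW.
have lE : l * sqn h = sqn (q - p) by rewrite divfK// gt_eqF.
have [y exty ymax] := farthest_extreme (p - l *: h) cG (ex_intro _ x Gx).
exists y => // Ky; have := ymax _ Gx.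
have -> : x - (p - l *: h) = (1 + l) *: h + 0 *: h.
  by apply/matrixP => i j; rewrite !mxE; ring.
have -> : y - (p - l *: h) = 1 *: (y - p) + l *: h.
  by apply/matrixP => i j; rewrite !mxE; ring.
rewrite !sqn_lincomb => H.
have h1 := var _ Ky; have h2 := qmax _ Ky.
have h3 : l * dot (y - p) h <= 0 by rewrite mulr_ge0_le0.
lra.
Qed.

End ExtremePoints.

(** * Pigeonhole arguments in a compact set *)

Section Pigeonhole.
Variables (R : realType) (d : nat) (G : set 'cV[R]_d).
Hypothesis cG : compact G.

Lemma compact_finite_net (e : R) : 0 < e ->
  exists s : seq 'cV[R]_d, forall x, G x -> exists2 c, c \in s & `|x - c| < e.
Proof.
move=> e0; move: (cG); rewrite compact_cover => /(_ _ G (fun c => ball c e)).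
case=> [c Gc|x Gx|D DG covD]; first exact: ball_open.
  by exists x => //; exact: ballxx.
exists (finmap.enum_fset D) => x /covD [c Dc]; rewrite -ball_normE /= => xc.
by exists c => //; rewrite distrC.
Qed.

(** Two of the points fall near the same centre of a finite net. The bound [N] depends on [e] alone,
    which later makes the number of cuts uniform over all nodes. *)
Lemma compact_close_pair (e : R) : 0 < e ->
  exists N : nat, forall f : nat -> 'cV[R]_d, (forall i, (i <= N)%N -> G (f i)) ->
    exists i j, (i < j <= N)%N /\ `|f i - f j| < e.
Proof.
move=> e0; have [|s sG] := @compact_finite_net (e / 2); first by rewrite divr_gt0.
exists (size s) => f fG.
have near (i : 'I_(size s).+1) : exists k : 'I_(size s), `|f i - nth 0 s k| < e / 2.
  have [c cs xc] := sG (f i) (fG i (leq_ord i)).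
  have ci : (index c s < size s)%N by rewrite index_mem.
  by exists (Ordinal ci); rewrite /= nth_index.
have [g gP] := choice near.
have : ~~ injectiveb g.
  apply/injectiveP => /leq_card; by rewrite !card_ord ltnn.
move=> /injectivePn[i [j ij gij]].
have close : `|f i - f j| < e.
  have := gP i; have := gP j; rewrite gij => h1 h2.
  rewrite (_ : f i - f j = (f i - nth 0 s (g j)) - (f j - nth 0 s (g j))); last first.
    by rewrite opprB addrA subrK.
  by rewrite (le_lt_trans (ler_normB _ _))//; lra.
have [lij|lij] := ltnP i j.
  by exists i, j; rewrite lij leq_ord.
exists j, i; rewrite leq_ord andbT ltn_neqAle lij andbT; split.
  by apply: contra ij => /eqP/val_inj->.
by rewrite distrC.
Qed.

(** Some centre of a finite net is near infinitely many terms; any of these terms serves as [n]. *)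
Lemma compact_recurrent (e : R) (f : nat -> 'cV[R]_d) : 0 < e -> (forall i, G (f i)) ->
  exists n, forall N, exists2 k, (N <= k)%N & (n < k)%N /\ `|f n - f k| < e.
Proof.
move=> e0 fG; have [|s sG] := @compact_finite_net (e / 2); first by rewrite divr_gt0.
have [c cP] : exists c, forall N, exists2 k, (N <= k)%N & `|f k - c| < e / 2.
  apply: contrapT => /forallNP H.
  have {}H c : exists N, forall k, (N <= k)%N -> ~ `|f k - c| < e / 2.
    have /existsNP[N NP] := H c; exists N => k Nk fkc; apply: NP; by exists k.
  have [h hP] := choice H.
  have [c cs] := sG (f (\max_(c <- s) h c)) (fG _).
  by apply: (hP c); apply: leq_bigmax_seq.
have [n _ nc] := cP 0%N; exists n => N.
have [k] := cP (maxn N n.+1); rewrite geq_max => /andP[Nk nk] kc.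
exists k => //; split => //.
rewrite (_ : f n - f k = (f n - c) - (f k - c)); last by rewrite opprB addrA subrK.
by rewrite (le_lt_trans (ler_normB _ _))//; lra.
Qed.

End Pigeonhole.

(** * Spectral radius *)

Section ComplexModulus.
Variable R : realType.
Implicit Types (z w : R[i]) (x : R).

Lemma cmodE z : (cmod z)%:C%C = `|z|.
Proof. by case: z => a b; rewrite normc_def. Qed.

Lemma cmod_ge0 z : 0 <= cmod z.
Proof. by case: z => a b; exact: sqrtr_ge0. Qed.

Lemma cmod0 : cmod (0 : R[i]) = 0.
Proof. exact: ComplexField.Normc.normc0. Qed.

Lemma cmod1 : cmod (1 : R[i]) = 1.
Proof. exact: ComplexField.Normc.normc1. Qed.

Lemma cmodM z w : cmod (z * w) = cmod z * cmod w.
Proof. exact: ComplexField.Normc.normcM. Qed.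

Lemma cmodV z : cmod z^-1 = (cmod z)^-1.
Proof. exact: ComplexField.Normc.normcV. Qed.

Lemma cmodD z w : cmod (z + w) <= cmod z + cmod w.
Proof. by rewrite -lecR rmorphD /= !cmodE; exact: ler_normD. Qed.

Lemma cmod_real x : cmod x%:C%C = `|x|.
Proof. by rewrite /cmod /= expr0n /= addr0 sqrtr_sqr. Qed.

Lemma cmod_eq0 z : (cmod z == 0) = (z == 0).
Proof.
by apply/eqP/eqP => [/ComplexField.Normc.eq0_normc//|->]; exact: cmod0.
Qed.

Lemma cmod_prod (I : Type) (r : seq I) (F : I -> R[i]) :
  cmod (\prod_(i <- r) F i) = \prod_(i <- r) cmod (F i).
Proof.
by elim: r => [|a r IH]; rewrite ?big_nil ?cmod1// !big_cons cmodM IH.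
Qed.

Lemma cmod_sub1_ge z : 1 - cmod z <= cmod (1 - z).
Proof.
by have := cmodD (1 - z) z; rewrite subrK cmod1 => ?; rewrite lerBlDr.
Qed.

End ComplexModulus.

Section SpectralRadius.
Variables (R : realType) (d : nat).
Implicit Types (M B : 'M[R]_d) (z w : R[i]).

Lemma char_poly_roots n (A : 'M[R[i]]_n) : exists2 rs : seq R[i],
  char_poly A = \prod_(w <- rs) ('X - w%:P) &
  size rs = n /\ forall w, (w \in rs) = eigenvalue A w.
Proof.
have [rs rsE] := closed_field_poly_normal (char_poly A).
rewrite (eqP (char_poly_monic A)) scale1r in rsE.
exists rs => //; split.
  by have := size_char_poly A; rewrite rsE size_prod_XsubC => -[].
by move=> w; rewrite eigenvalue_root_char rsE root_prod_XsubC.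
Qed.

Lemma eigenvalue_le_radius M z :
  eigenvalue (complexify M) z -> cmod z <= spectral_radius M.
Proof.
move=> ev; apply: ub_le_sup; last by exists z.
have [rs _ [_ rsP]] := char_poly_roots (complexify M).
exists (\sum_(w <- rs) cmod w) => _ [w /= + <-]; rewrite -rsP => wrs.
rewrite (big_rem w)//= lerDl; apply: sumr_ge0 => i _; exact: cmod_ge0.
Qed.

Lemma leading_radius M z : leading_eigenvalue M z -> spectral_radius M = cmod z.
Proof.
move=> [ev lead]; apply/eqP; rewrite eq_le eigenvalue_le_radius// andbT.
by apply: ge_sup => [|_ [w /= ew <-]]; [exists (cmod z), z|exact: lead].
Qed.

Lemma spectral_radius_ge0 M : 0 <= spectral_radius M.
Proof.
have [[z ev]|nev] := pselect (exists z, eigenvalue (complexify M) z).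
  exact: le_trans (cmod_ge0 z) (eigenvalue_le_radius ev).
rewrite /spectral_radius (_ : [set cmod z | z in _] = set0) ?sup0//.
by apply/seteqP; split=> // _ [z /= ev _]; apply: nev; exists z.
Qed.

(** The determinant is the product of the [d] factors [1 - w] over the eigenvalues, each of modulus
    at least [e]. *)
Lemma det_one_sub_ge B (e : R) : 0 <= e ->
  (forall w, eigenvalue (complexify B) w -> cmod w <= 1 - e) ->
  e ^+ d <= `|\det (1%:M - B)|.
Proof.
move=> e0 evB.
have [rs rsE [szrs rsP]] := char_poly_roots (complexify B).
have -> : `|\det (1%:M - B)| = \prod_(w <- rs) cmod (1 - w).
  rewrite -cmod_real -det_map_mx -cmod_prod; congr cmod.
  transitivity ((char_poly (complexify B)).[1]).
    rewrite -[LHS]/(\det _) -horner_evalE /char_poly -det_map_mx; congr (\det _).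
    apply/matrixP => i j; rewrite !mxE /= horner_evalE !hornerE.
    by rewrite hornerMn hornerX rmorphB rmorphMn rmorph1.
  by rewrite rsE horner_prod; apply: eq_bigr => w _; rewrite !hornerE.
rewrite -szrs; have {}rsP w : w \in rs -> cmod w <= 1 - e by rewrite rsP; exact: evB.
elim: rs {rsE szrs} rsP => [|w rs IH] rsP; first by rewrite big_nil expr0.
rewrite big_cons exprS ler_pM ?exprn_ge0//; last first.
  by apply: IH => v vrs; apply: rsP; rewrite in_cons vrs orbT.
rewrite (le_trans _ (cmod_sub1_ge w))//.
by have := rsP w; rewrite mem_head => /(_ isT); lra.
Qed.

Lemma eigenvalue_scale M (c : R) z : c != 0 ->
  eigenvalue (complexify (c *: M)) z -> eigenvalue (complexify M) (z / c%:C%C).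
Proof.
move=> c0 /eigenvalueP[v vE v0]; apply/eigenvalueP; exists v => //.
have cC : c%:C%C != 0 :> R[i] by rewrite fmorph_eq0.
move: vE; rewrite /complexify map_mxZ -scalemxAr => vE.
by apply: (scalerI cC); rewrite vE scalerA mulrCA divff// mulr1.
Qed.

End SpectralRadius.

Lemma det_norm_le (R : realType) n (M : 'M[R]_n) (b : R) :
  (forall i j, `|M i j| <= b) -> `|\det M| <= n`!%:R * b ^+ n.
Proof.
move=> Mb; rewrite /determinant (le_trans (ler_norm_sum _ _ _))//.
apply: (@le_trans _ _ (\sum_(s : 'S_n) b ^+ n)).
  apply: ler_sum => s _; rewrite normrM normrX normrN1 expr1n mul1r normr_prod.
  by rewrite -[X in _ ^+ X]card_ord -prodr_const; apply: ler_prod => i _; rewrite normr_ge0 Mb.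
by rewrite sumr_const card_Sn mulr_natl.
Qed.

(** * A lower bound for the displacement of non-interior points *)

Section Displacement.
Variables (R : realType) (d : nat) (G : set 'cV[R]_d).
Hypothesis bodyG : symmetric_convex_body G.

(** Up to the factor [r / 2], the columns of [B] are images of short basis vectors lying in [G],
    hence bounded by the size of [G]. *)
Lemma body_entries_bounded : exists2 b : R, 0 < b &
  forall B : 'M[R]_d, (forall x, G x -> G (B *m x)) -> forall i j, `|B i j| <= b.
Proof.
have [r r0 rG] := body_ball bodyG; have [C C0 GC] := body_bounded bodyG.
exists (2 / r * C); first by rewrite mulr_gt0// divr_gt0.
move=> B BG i j.
have Ge : G ((r / 2) *: delta_mx j ord0).
  apply: rG; apply: (@le_lt_trans _ _ (r / 2)); last by lra.
  apply: mx_norm_le => [|k l]; first by lra.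
  rewrite !mxE normrM ger0_norm; last by lra.
  by case: (_ && _); rewrite /= ?normr1 ?normr0; lra.
have := GC _ (BG _ Ge); rewrite -scalemxAr -colE => H.
have := le_trans (norm_coord_le _ i ord0) H; rewrite !mxE normrM ger0_norm; last by lra.
by move=> ?; rewrite mulrAC ler_pdivlMr//; lra.
Qed.

(* If [Bx] is close to [x] then [1 - B] is nearly singular, as its adjugate is
   bounded; but its determinant is at least [e ^ d]. *)
Lemma displacement_ge (e : R) : 0 < e -> exists2 delta : R, 0 < delta &
  forall (B : 'M[R]_d) x, (forall y, G y -> G (B *m y)) ->
    (forall w, eigenvalue (complexify B) w -> cmod w <= 1 - e) ->
    ~ G° x -> delta <= `|B *m x - x|.
Proof.
move=> e0; have [b b0 bP] := body_entries_bounded.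
have [r r0 rP] := body_norm_ge bodyG.
pose K := d.-1`!%:R * (1 + b) ^+ d.-1.
have K0 : 0 < K by rewrite mulr_gt0 ?ltr0n ?fact_gt0// exprn_gt0//; lra.
(* The summand 1 keeps the divisor positive in dimension 0. *)
have L0 : 0 < d%:R * K + 1 by rewrite ltr_wpDl// mulr_ge0// ltW.
exists (e ^+ d * r / (d%:R * K + 1)).
  by rewrite divr_gt0// mulr_gt0// exprn_gt0.
move=> B x BG evB nx.
have detB := det_one_sub_ge (ltW e0) evB.
have adjK : `|\adj (1%:M - B)| <= K.
  apply: mx_norm_le => [|i j]; first exact: ltW.
  rewrite mxE normrM normrX normrN1 expr1n mul1r; apply: det_norm_le => k l.
  rewrite !mxE (le_trans (ler_normB _ _))// lerD// ?bP//.
  by case: (_ == _); rewrite ?normr1 ?normr0.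
have E : \det (1%:M - B) *: x = \adj (1%:M - B) *m (x - B *m x).
  by rewrite -{2}[x]mul1mx -mulmxBl mulmxA mul_adj_mx mul_scalar_mx.
have H := norm_mulmx_le (\adj (1%:M - B)) (x - B *m x).
rewrite -E normrZ in H.
rewrite ler_pdivrMr// -normrN opprB.
have rx := rP _ nx.
apply: (@le_trans _ _ (`|\det (1%:M - B)| * `|x|)).
  by rewrite ler_pM// ?exprn_ge0 ?ltW.
rewrite (le_trans H)// mulrC ler_wpM2l//.
by rewrite (@le_trans _ _ (d%:R * K))// ?lerDl// ler_wpM2l.
Qed.

End Displacement.

(** * Products of words and backward orbits *)

Section Words.
Variables (R : realType) (d m : nat) (B : 'I_m -> 'M[R]_d).
Implicit Types (w u : seq 'I_m).

Lemma word_prod_cat w u : word_prod B (w ++ u) = word_prod B u *m word_prod B w.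
Proof.
rewrite /word_prod foldl_cat; move: (foldl _ _ w) => N; elim/last_ind: u => [|u i IH].
  by rewrite mul1mx.
by rewrite !foldl_rcons IH mulmxA.
Qed.

Lemma word_prod1 i : word_prod B [:: i] = B i.
Proof. by rewrite /word_prod /= mulmx1. Qed.

Lemma wpowS w k : wpow w k.+1 = w ++ wpow w k.
Proof. by []. Qed.

Lemma size_wpow w k : size (wpow w k) = (k * size w)%N.
Proof. by elim: k => // k IH; rewrite wpowS size_cat IH mulSn. Qed.

Lemma word_prod_wpow w k : word_prod B (wpow w k) = word_prod B w ^+ k.
Proof.
by elim: k => [|k IH]; rewrite ?expr0// wpowS word_prod_cat IH exprSr.
Qed.

Lemma wpow_rot w u k : wpow (w ++ u) k ++ w = w ++ wpow (u ++ w) k.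
Proof. by elim: k => [|k IH]; rewrite /= ?cats0// !wpowS -!catA IH. Qed.

End Words.

Lemma word_prod_scale (R : realType) (d m : nat) (A : 'I_m -> 'M[R]_d) (c : R) w :
  word_prod (fun i => c *: A i) w = c ^+ size w *: word_prod A w.
Proof.
elim/last_ind: w => [|w i IH]; first by rewrite expr0 scale1r.
rewrite -cats1 !word_prod_cat IH !word_prod1 size_cat addn1 exprS.
by rewrite -scalemxAr -scalemxAl scalerA mulrC.
Qed.

Section InvariantSets.
Variables (R : realType) (d m : nat) (B : 'I_m -> 'M[R]_d) (G : set 'cV[R]_d).
Hypothesis bodyG : symmetric_convex_body G.
Hypothesis BG : forall i, forall x, G x -> G (B i *m x).

Lemma word_prod_sub w x : G x -> G (word_prod B w *m x).
Proof.
elim/last_ind: w x => [|w i IH] x Gx; first by rewrite mul1mx.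
by rewrite -cats1 word_prod_cat word_prod1 -mulmxA; apply/BG/IH.
Qed.

Lemma word_prod_interior w x : G° x -> G° (word_prod B w *m x).
Proof. exact/body_interior_mulmx/word_prod_sub. Qed.

(* Letters of backward orbits come last first. *)
Definition backward_word (a : nat -> 'I_m) n k : seq 'I_m :=
  rev (mkseq (fun l => a (n + l)%N) k).

Lemma size_backward_word a n k : size (backward_word a n k) = k.
Proof. by rewrite size_rev size_mkseq. Qed.

Lemma backward_wordE a (x : nat -> 'cV[R]_d) n k :
  (forall l, x l = B (a l) *m x l.+1) ->
  x n = word_prod B (backward_word a n k) *m x (n + k)%N.
Proof.
move=> xS; elim: k => [|k IH]; first by rewrite addn0 mul1mx.
rewrite {1}IH xS /backward_word mkseqS rev_rcons -cat1s word_prod_cat word_prod1.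
by rewrite mulmxA addnS.
Qed.

Hypothesis extG : forall x, extreme_point G x -> exists i, exists2 y, G y & x = B i *m y.

Lemma backward_orbit x0 : extreme_point G x0 ->
  exists (x : nat -> 'cV[R]_d) (a : nat -> 'I_m),
    [/\ x 0%N = x0, forall k, extreme_point G (x k) & forall k, x k = B (a k) *m x k.+1].
Proof.
move=> ext0.
have step (x : {x | extreme_point G x}) :
  exists p : 'I_m * {x | extreme_point G x}, sval x = B p.1 *m sval p.2.
  have [i [y0 Gy0 xy0]] := extG (svalP x).
  have [y exty xy] := extreme_preimage (body_compact bodyG) (BG i) (svalP x) Gy0 xy0.
  by exists (i, exist _ y exty).
have [f fP] := choice step.
pose x k := iter k (fun p => (f p).2) (exist _ x0 ext0).
exists (fun k => sval (x k)), (fun k => (f (x k)).1); split => //.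
by move=> k; exact: svalP.
Qed.

(** An interior point is the midpoint of [x + v] and [x - v] for a short nonzero [v]. In dimension 0
    no such [v] exists and the only point is both extreme and interior. *)
Lemma extreme_not_interior x : (0 < d)%N -> extreme_point G x -> ~ G° x.
Proof.
move=> d0 [Gx ext] ix.
have [j] : exists v : 'cV[R]_d, v != 0.
  exists (delta_mx (Ordinal d0) ord0); apply/eqP => /matrixP/(_ (Ordinal d0) ord0).
  by rewrite !mxE !eqxx /= => /eqP; rewrite oner_eq0.
move=> j0; have [e e0 eG] : exists2 e : R, 0 < e & forall y, `|x - y| < e -> G y.
  by move: ix => /nbhs_ballP[e /= e0 eG]; exists e => // y xy; apply: eG; rewrite -ball_normE.
have nj : 0 < `|j| by rewrite normr_gt0.
pose v := (e / 2 / `|j|) *: j.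
have nv : `|v| < e.
  rewrite normrZ ger0_norm ?divr_ge0 ?ltW// divfK ?gt_eqF//; lra.
have : x + v = x - v.
  apply: (ext _ _ (1 / 2)).
  - by apply: eG; rewrite opprD addNKr normrN.
  - by apply: eG; rewrite opprB addrC subrK.
  - by lra.
  - by move: v {nv} => v; apply/matrixP => k l; rewrite !mxE; field.
move/addrI/eqP; rewrite -addr_eq0 -mulr2n -scaler_nat scaler_eq0 pnatr_eq0 orFb.
have v0 : 0 < e / 2 / `|j| by rewrite !divr_gt0.
by rewrite /v scaler_eq0 (negbTE j0) orbF gt_eqF.
Qed.

End InvariantSets.

(** * Consequences of the invariance equation *)

Section HullInvariance.
Variables (R : realType) (d m : nat) (A : 'I_m -> 'M[R]_d) (G : set 'cV[R]_d) (rho : R).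
Hypothesis bodyG : symmetric_convex_body G.
Hypothesis hullG : convex_hull (\bigcup_i [set A i *m x | x in G]) = [set rho *: x | x in G].

(** The sign of [rho] is left open in this section; symmetry of [G] allows its replacement by the
    absolute value. *)
Lemma body_opp_norm x : G x -> exists2 y, G y & rho *: x = `|rho| *: y.
Proof.
move=> Gx; have [r0|r0] := ger0P rho; first by exists x.
by exists (- x); [exact: body_opp|rewrite scalerN scaleNr opprK].
Qed.

Lemma body_norm_opp x : G x -> exists2 y, G y & `|rho| *: x = rho *: y.
Proof.
move=> Gx; have [r0|r0] := ger0P rho; first by exists x.
by exists (- x); [exact: body_opp|rewrite scalerN scaleNr].
Qed.

Lemma hull_image i x : G x -> exists2 y, G y & A i *m x = `|rho| *: y.
Proof.
move=> Gx; have : [set rho *: x | x in G] (A i *m x).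
  by rewrite -hullG; apply: subset_convex_hull; exists i => //; exists x.
by move=> [y Gy <-]; exact: body_opp_norm.
Qed.

Hypothesis rho0 : rho != 0.

Lemma hull_scaled_image i x : G x -> G ((`|rho|^-1 *: A i) *m x).
Proof.
move=> /(hull_image i)[y Gy E]; rewrite -scalemxAl E scalerA mulVf ?normr_eq0//.
by rewrite scale1r.
Qed.

(** The point [rho *: x] is extreme in the hull of the images of [G], so it belongs to one of these
    images. *)
Lemma hull_scaled_preimage x : extreme_point G x ->
  exists i, exists2 y, G y & x = (`|rho|^-1 *: A i) *m y.
Proof.
move=> [Gx ext]; have : extreme_point (convex_hull (\bigcup_i [set A i *m x | x in G])) (rho *: x).
  rewrite hullG; split; first by exists x.
  move=> _ _ t [y Gy <-] [z Gz <-] t01 E; congr (_ *: _); apply: (ext y z t) => //.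
  by apply: (scalerI rho0); rewrite E scalerDr !scalerA mulrC [(1 - t) * _]mulrC.
move=> /extreme_convex_hull[i _ [y Gy E]]; exists i.
have [y' Gy' E'] := body_norm_opp Gy.
have nr0 : `|rho| != 0 by rewrite normr_eq0.
have [y'' Gy'' E''] := body_opp_norm Gy.
(* The factor is the sign of [rho], so the witness is [y] or [- y]. *)
exists (`|rho| / rho *: y); last first.
  by rewrite -scalemxAr -scalemxAl scalerA mulrAC divff// mul1r E scalerA mulVf// scale1r.
have [r0|r0] := ger0P rho; first by rewrite divff// scale1r.
by rewrite mulNr divff// scaleN1r; exact: body_opp.
Qed.

End HullInvariance.

(** * Recurrence of backward orbits *)

Section Recurrence.
Variables (R : realType) (d m : nat) (B : 'I_m -> 'M[R]_d) (G : set 'cV[R]_d).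
Variables (s : seq 'I_m) (e : R).
Hypothesis bodyG : symmetric_convex_body G.
Hypothesis BG : forall i, forall x, G x -> G (B i *m x).
Hypothesis e0 : 0 < e.
Hypothesis gap : forall w, w <> [::] ->
  (forall z, eigenvalue (complexify (word_prod B w)) z -> cmod z <= 1 - e) \/
  exists j k, w = wpow (rot j s) k.

(** A return closer than the bound of [displacement_ge] rules out the spectral alternative of [gap];
    that bound is the same for all words. *)
Lemma close_return : exists2 delta : R, 0 < delta & forall w x, w <> [::] ->
  ~ G° x -> `|word_prod B w *m x - x| < delta -> exists j k, w = wpow (rot j s) k.
Proof.
have [delta delta0 dP] := displacement_ge bodyG e0; exists delta => // w x w0 nx wx.
have [ev|//] := gap w0.
have := dP _ x (fun y => word_prod_sub BG w (x := y)) ev nx.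
by rewrite leNgt wx.
Qed.

Lemma rot_small j : (0 < size s)%N -> exists i : 'I_(size s), rot j s = rot i s.
Proof.
move=> s0; have [js|sj] := ltnP j (size s); first by exists (Ordinal js).
by exists (Ordinal s0); rewrite rot0 rot_oversize.
Qed.

Hypothesis extG : forall x, extreme_point G x -> exists i, exists2 y, G y & x = B i *m y.

(** In a backward orbit of extreme points take a recurrent term [x]: the words of its close returns
    are powers of cyclic permutations of [s], of unbounded length. *)
Lemma extreme_orbit_tail x0 : (0 < d)%N -> (0 < size s)%N -> extreme_point G x0 ->
  exists x w (j : 'I_(size s)), [/\ extreme_point G x, x0 = word_prod B w *m x &
    forall N, exists2 k, (N <= k)%N &
      exists2 y, G y & x = word_prod B (wpow (rot j s) k) *m y].
Proof.
move=> d0 s0 ext0; have [x [a [x00 extx xS]]] := backward_orbit bodyG BG extG ext0.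
have [delta delta0 dP] := close_return.
have [n nP] := compact_recurrent (body_compact bodyG) delta0 (fun i => (extx i).1).
have ret N : exists2 k, (N <= k)%N & exists j : 'I_(size s),
    x n = word_prod B (wpow (rot j s) k) *m x (n + k * size s)%N.
  (* A return at least [N * size s] steps away encloses at least [N] periods. *)
  have [l Nl [nl close]] := nP (n + N * size s)%N.
  have lE : l = (n + (l - n))%N by rewrite subnKC// ltnW.
  have xE := @backward_wordE _ _ _ B a x n (l - n) xS; rewrite -lE in xE.
  have [|||j [k wE]] := dP (backward_word a n (l - n)) (x l).
  - by move/(congr1 size); rewrite size_backward_word /=; lia.
  - exact: extreme_not_interior (extx l).
  - by rewrite -xE.
  have [i ji] := rot_small j s0; rewrite ji in wE.
  have := congr1 size wE; rewrite size_backward_word size_wpow size_rot => sz.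
  exists k; first by rewrite -(leq_pmul2r s0); lia.
  by exists i; rewrite -sz -lE xE wE.
(* There are finitely many cyclic permutations, so one of them occurs with unboundedly many
   exponents. *)
have [j jP] : exists j : 'I_(size s), forall N, exists2 k, (N <= k)%N &
    x n = word_prod B (wpow (rot j s) k) *m x (n + k * size s)%N.
  apply: contrapT => /forallNP H.
  have {}H (j : 'I_(size s)) : exists N, forall k, (N <= k)%N ->
      ~ x n = word_prod B (wpow (rot j s) k) *m x (n + k * size s)%N.
    have /existsNP[N NP] := H j; exists N => k Nk E; apply: NP; by exists k.
  have [h hP] := choice H.
  have [k hk [j E]] := ret (\max_j h j).
  by apply: (hP j k) E; apply: leq_trans hk; exact: leq_bigmax.
exists (x n), (backward_word a 0 n), j; split => //.
  by rewrite -x00 {1}(@backward_wordE _ _ _ B a x 0%N n xS).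
move=> N; have [k Nk E] := jP N; exists k => //.
by exists (x (n + k * size s)%N) => //; exact: (extx _).1.
Qed.

End Recurrence.

(** * The leading eigenvalue *)

Lemma contracting_recurrence (R : realType) (c : R) (a b : nat -> R) :
  0 <= c < 1 -> (forall k, 0 <= a k) -> (forall k, a k.+1 <= c * a k + b k) ->
  (forall e, 0 < e -> exists K, forall k, (K <= k)%N -> b k <= e) ->
  forall e, 0 < e -> exists K, forall k, (K <= k)%N -> a k <= e.
Proof.
move=> /andP[c0 c1] a0 aS b0 e e0.
(* With this bound on [b], the value [e / 2] is the fixed point of the recurrence. *)
have [K KP] := b0 (e / 2 * (1 - c)) ltac:(by rewrite mulr_gt0 ?divr_gt0 ?subr_gt0).
have step i : a (K + i)%N <= c ^+ i * a K + e / 2.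
  elim: i => [|i IH]; first by rewrite addn0 expr0 mul1r lerDl divr_ge0// ltW.
  rewrite addnS (le_trans (aS _))//.
  have := ler_wpM2l c0 IH; have := KP _ (leq_addr i K); rewrite exprS.
  move: (c ^+ i) => ci; move=> h1 h2; nra.
have : (fun n => c ^+ n * a K) @ \oo --> (0 : R).
  rewrite -[X in _ --> X](mul0r (a K)); apply: cvgMl.
  by apply: cvg_expr; rewrite ger0_norm.
move=> /cvgrPdist_le /(_ (e / 2)) []; first by rewrite divr_gt0.
move=> N _ NP; exists (K + N)%N => k Kk.
have -> : k = (K + (k - K))%N by lia.
have := NP (k - K)%N; rewrite /= sub0r normrN ger0_norm; last by rewrite mulr_ge0// exprn_ge0.
have Nk : (N <= k - K)%N by lia.
move=> /(_ Nk); have := step (k - K)%N; lra.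
Qed.

Section Decay.
Variables (R : realType) (d p : nat).
Implicit Types (M : 'M[R[i]]_d.+1) (X : 'M[R[i]]_(d.+1, p)).

Definition sum_cmod X : R := \sum_i \sum_j cmod (X i j).

Lemma sum_cmod_ge0 X : 0 <= sum_cmod X.
Proof. by do 2 (apply: sumr_ge0 => ? _); exact: cmod_ge0. Qed.

Lemma sum_cmodD X Y : sum_cmod (X + Y) <= sum_cmod X + sum_cmod Y.
Proof.
rewrite /sum_cmod -big_split; apply: ler_sum => i _ /=.
by rewrite -big_split; apply: ler_sum => j _; rewrite mxE; exact: cmodD.
Qed.

Lemma sum_cmodZ z X : sum_cmod (z *: X) = cmod z * sum_cmod X.
Proof.
rewrite /sum_cmod mulr_sumr; apply: eq_bigr => i _.
by rewrite mulr_sumr; apply: eq_bigr => j _; rewrite mxE cmodM.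
Qed.

Lemma cmod_le_sum X i j : cmod (X i j) <= sum_cmod X.
Proof.
rewrite /sum_cmod (bigD1 i)//= (bigD1 j)//= -addrA lerDl addr_ge0//.
  by apply: sumr_ge0 => ? _; exact: cmod_ge0.
by do 2 (apply: sumr_ge0 => ? _); exact: cmod_ge0.
Qed.

(* Induction on the roots: if [Y = (M - w) X] decays then so does [X], because
   [M ^ (k + 1) X = w M ^ k X + M ^ k Y]. *)
Lemma annihilated_decay M X (c : R) (rs : seq R[i]) : 0 < c ->
  (forall w, w \in rs -> cmod w < c) ->
  horner_mx M (\prod_(w <- rs) ('X - w%:P)) *m X = 0 ->
  forall e, 0 < e -> exists K, forall k, (K <= k)%N -> sum_cmod (M ^+ k *m X) <= e * c ^+ k.
Proof.
move=> c0; elim: rs X => [|w rs IH] X rsc.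
  rewrite big_nil rmorph1 mul1mx => -> e e0; exists 0%N => k _.
  rewrite mulmx0 /sum_cmod big1 ?mulr_ge0 ?exprn_ge0 ?ltW// => i _.
  by rewrite big1// => j _; rewrite mxE cmod0.
rewrite big_cons mulrC rmorphM /= => H.
pose Y := (M - w%:M) *m X.
have HY : horner_mx M (\prod_(v <- rs) ('X - v%:P)) *m Y = 0.
  by rewrite /Y mulmxA -[RHS]H rmorphB /= horner_mx_X horner_mx_C.
have {}IH := IH Y (fun v vrs => rsc v (mem_behead (s := w :: rs) vrs)) HY.
have wc : cmod w < c by apply: rsc; rewrite mem_head.
have XS k : M ^+ k.+1 *m X = w *: (M ^+ k *m X) + M ^+ k *m Y.
  rewrite exprSr -[_ * M]/(_ *m M) -mulmxA /Y mulmxBl mulmxBr mul_scalar_mx -scalemxAr.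
  by rewrite addrC subrK.
have cn k : 0 < c ^+ k by rewrite exprn_gt0.
move=> e e0.
have [||||K KP] := @contracting_recurrence R (cmod w / c)
  (fun k => sum_cmod (M ^+ k *m X) / c ^+ k)
  (fun k => sum_cmod (M ^+ k *m Y) / c ^+ k.+1) _ _ _ _ e e0.
- by rewrite divr_ge0 ?cmod_ge0 ?ltW//= ltr_pdivrMr// mul1r.
- by move=> k; rewrite divr_ge0 ?sum_cmod_ge0// ltW.
- move=> k; rewrite XS mulf_div -exprS -mulrDl ler_wpM2r ?invr_ge0 ?(ltW (cn _))//.
  by rewrite (le_trans (sum_cmodD _ _))// sum_cmodZ.
- move=> f f0; have [K KP] := IH (f * c) (mulr_gt0 f0 c0).
  by exists K => k /KP; rewrite ler_pdivrMr// exprS mulrA.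
by exists K => k /KP; rewrite ler_pdivrMr.
Qed.

End Decay.

(** In a basis whose first [r] rows span the eigenspace, the first [r] rows of the characteristic
    matrix are divisible by ['X - a%:P]; these factors come out of the determinant. *)
Lemma rank_eigenspace_le_mup (F : fieldType) n (A : 'M[F]_n) (a : F) :
  (\rank (eigenspace A a) <= mup a (char_poly A))%N.
Proof.
set E := eigenspace A a; set r := \rank E.
have rn : (r <= n)%N by exact: rank_leq_row.
pose C := row_ebase E.
have Crow (i : 'I_n) : (i < r)%N -> row i C *m A = a *: row i C.
  move=> ir; apply/eigenspaceP; rewrite -/E.
  have -> : row i C = row i (pid_mx r *m C).
    apply/rowP => j; rewrite !mxE (bigD1 i)//= !mxE eqxx ir mul1r big1 ?addr0// => k ki.
    rewrite !mxE (_ : (i == k :> nat) = false) ?mul0r//.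
    by apply/negbTE; rewrite eq_sym; exact: ki.
  apply: submx_trans (row_sub _ _) _.
  have -> : pid_mx r *m C = invmx (col_ebase E) *m E.
    by rewrite -{2}(mulmx_ebase E) !mulmxA mulVmx ?col_ebase_unit// mul1mx.
  exact: submxMl.
pose D : 'rV[{poly F}]_n := \row_i (if (i < r)%N then 'X - a%:P else 1).
pose Cp := map_mx (@polyC F) C.
pose C' : 'M[{poly F}]_n := \matrix_(i, j)
  (if (i < r)%N then (C i j)%:P else (Cp *m char_poly_mx A) i j).
have E1 : Cp *m char_poly_mx A = diag_mx D *m C'.
  apply/matrixP => i j; rewrite mul_diag_mx [RHS]mxE [X in X * _]mxE [X in _ * X]mxE.
  have [ir|_] := ltnP i r; last by rewrite mul1r.
  rewrite /char_poly_mx mulmxBr mul_mx_scalar -map_mxM !mxE mulrBl; congr (_ - _).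
  have := congr1 (fun v : 'rV_n => v 0 j) (Crow i ir); rewrite -row_mul !mxE => ->.
  exact: polyCM.
have C0 : \det C != 0 by have := row_ebase_unit E; rewrite unitmxE unitfE.
have detC : \det Cp \is a GRing.unit.
  by rewrite det_map_mx poly_unitE size_polyC coefC eqxx C0 unitfE C0.
have detD : \det (diag_mx D) = ('X - a%:P) ^+ r.
  rewrite det_diag; under eq_bigr do rewrite mxE.
  by rewrite -big_mkcond /= (big_ord_narrow rn) prodr_const card_ord.
have E2 := congr1 determinant E1; rewrite !det_mulmx detD -/(char_poly A) in E2.
rewrite mup_geq ?monic_neq0 ?char_poly_monic//.
have -> : char_poly A = ('X - a%:P) ^+ r * ((\det Cp)^-1 * \det C').
  by rewrite mulrCA -E2 mulKr.
exact: dvdp_mulIl.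
Qed.

Lemma char_poly_trmx (R : comNzRingType) n (A : 'M[R]_n) : char_poly A^T = char_poly A.
Proof.
rewrite /char_poly -[RHS]det_tr; congr (\det _).
by rewrite /char_poly_mx linearB /= tr_scalar_mx map_trmx.
Qed.

Section LeadingEigenvalue.
Variables (R : realType) (d : nat) (M : 'M[R]_d.+1) (z : R[i]).
Implicit Types (x : 'cV[R]_d.+1) (v : 'cV[R[i]]_d.+1).

Local Notation Mc := (complexify M).
Local Notation toC := (map_mx (real_complex R)).

Lemma Im_mul_real (a : R[i]) (b : R) : complex.Im (a * b%:C%C) = complex.Im a * b.
Proof. by case: a => u v /=; rewrite mulr0 add0r. Qed.

Lemma cmod_sqr : ((cmod z) ^+ 2)%:C%C = z * conjc z.
Proof. by rewrite rmorphXn /= cmodE sqr_normc. Qed.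

(** This is [(M - z) (M - conj z)] with real coefficients. For a simple non-real leading eigenvalue
    its kernel is the leading plane, which gives a real description of that plane. *)
Definition leading_quadratic : 'M[R]_d.+1 :=
  M *m M - (2 * complex.Re z) *: M + ((cmod z) ^+ 2)%:M.

Lemma complexify_quadratic :
  complexify leading_quadratic = (Mc - z%:M) *m (Mc - (conjc z)%:M).
Proof.
rewrite /leading_quadratic /complexify map_mxD map_mxB map_mxM map_mxZ map_scalar_mx /=.
rewrite cmod_sqr mulmxBl !mulmxBr mul_mx_scalar !mul_scalar_mx scale_scalar_mx.
have -> : (2 * complex.Re z)%:C%C = z + conjc z by rewrite addcJ rmorphM rmorph_nat.
rewrite -/(complexify M); move: (Mc *m Mc) (_%:M) => P S.
by apply/matrixP => i j; rewrite !mxE; ring.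
Qed.

Lemma quadratic_comm : leading_quadratic *m M = M *m leading_quadratic.
Proof.
rewrite /leading_quadratic mulmxDl mulmxDr mulmxBl mulmxBr mulmxA scalar_mxC.
by rewrite -scalemxAl -scalemxAr.
Qed.

Hypothesis lead : unique_simple_leading_eigenvalue M z.
Hypothesis nonreal : complex.Im z != 0.

Lemma leading_neq0 : z != 0.
Proof. by apply: contraNneq nonreal => ->. Qed.

Lemma leading_cmod_gt0 : 0 < cmod z.
Proof. by rewrite lt_def cmod_ge0 andbT cmod_eq0 leading_neq0. Qed.

Lemma leading_conj_neq : conjc z != z.
Proof.
rewrite eq_complex; case: z nonreal => a b /= b0; rewrite eqxx /=.
by rewrite -subr_eq0 -opprD oppr_eq0 -mulr2n mulrn_eq0.
Qed.

Lemma char_poly_conj : map_poly conjc (char_poly Mc) = char_poly Mc.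
Proof.
rewrite map_char_poly; congr char_poly; apply/matrixP => i j.
by rewrite !mxE; exact: conjc_real.
Qed.

Lemma root_conj w : root (char_poly Mc) w -> root (char_poly Mc) (conjc w).
Proof. by rewrite -{2}char_poly_conj /root horner_map fmorph_eq0. Qed.

Lemma leading_root : root (char_poly Mc) z.
Proof. by rewrite -eigenvalue_root_char; have [[]] := lead. Qed.

Lemma leading_no_double : ~~ (('X - z%:P) ^+ 2 %| char_poly Mc).
Proof.
by have [_ mupz _] := lead; rewrite -mup_geq ?mupz// monic_neq0// char_poly_monic.
Qed.

Lemma conj_no_double : ~~ (('X - (conjc z)%:P) ^+ 2 %| char_poly Mc).
Proof.
apply: contra leading_no_double; rewrite -(dvdp_map conjc) char_poly_conj.
rewrite rmorphXn rmorphB /= map_polyX map_polyC /=.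
by rewrite (_ : GRing.RMorphism.sort _ _ = z) //; exact: conjcK.
Qed.

(** After removing one copy of [z] and one of its conjugate, neither can occur again, since the
    characteristic polynomial has no double root there; uniqueness of the leading eigenvalue bounds
    the rest. *)
Lemma subleading_roots : exists2 rs : seq R[i], (forall w, w \in rs -> cmod w < cmod z) &
  char_poly Mc = (\prod_(w <- rs) ('X - w%:P)) * (('X - z%:P) * ('X - (conjc z)%:P)).
Proof.
have [rs0 E [_ evE]] := char_poly_roots Mc.
have rsz : z \in rs0 by rewrite evE eigenvalue_root_char leading_root.
have rszb : conjc z \in rem z rs0.
  have : conjc z \in z :: rem z rs0.
    rewrite -(perm_mem (perm_to_rem rsz)) evE eigenvalue_root_char.
    exact/root_conj/leading_root.
  by rewrite in_cons (negbTE leading_conj_neq).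
pose rs := rem (conjc z) (rem z rs0).
have prs : perm_eq rs0 (z :: conjc z :: rs).
  by rewrite (perm_trans (perm_to_rem rsz))// perm_cons perm_to_rem.
have E' : char_poly Mc = (\prod_(w <- rs) ('X - w%:P)) * (('X - z%:P) * ('X - (conjc z)%:P)).
  by rewrite E (perm_big _ prs) /= !big_cons mulrA mulrC.
exists rs => // w wrs; have [_ _ sub] := lead; apply: sub.
- by rewrite -evE (perm_mem prs) !in_cons wrs !orbT.
- move=> wz; move: leading_no_double; rewrite E' -wz (big_rem _ wrs) /=.
  by rewrite mulrACA -expr2 dvdp_mulIl.
- move=> [_ wz]; move: conj_no_double; rewrite E' -wz (big_rem _ wrs) /=.
  by rewrite [X in _ %| _ * X]mulrC mulrACA -expr2 dvdp_mulIl.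
Qed.

(** By Cayley-Hamilton the product over the subleading roots annihilates the quadratic factor, so
    [annihilated_decay] applies: off the leading plane the powers of [M] are negligible against
    [cmod z ^+ k]. *)
Lemma quadratic_decay (e : R) : 0 < e ->
  exists K, forall k, (K <= k)%N -> `|M ^+ k *m leading_quadratic| <= e * cmod z ^+ k.
Proof.
move=> e0; have [rs rsz E] := subleading_roots.
have ann : horner_mx Mc (\prod_(w <- rs) ('X - w%:P)) *m complexify leading_quadratic = 0.
  rewrite complexify_quadratic -[RHS](Cayley_Hamilton Mc) E !rmorphM !rmorphB /=.
  by rewrite horner_mx_X !horner_mx_C.
have [K KP] := @annihilated_decay R d d.+1 Mc (complexify leading_quadratic) _ rs
  leading_cmod_gt0 rsz ann e e0.
exists K => k Kk; apply: mx_norm_le => [|i j].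
  by rewrite mulr_ge0 ?exprn_ge0 ?cmod_ge0 ?ltW.
apply: le_trans (KP k Kk); apply: le_trans (cmod_le_sum _ i j).
rewrite -cmod_real le_eqVlt; apply/orP; left; apply/eqP; congr cmod.
by rewrite /complexify -rmorphXn -map_mxM [RHS]mxE.
Qed.

Lemma leading_eigenvector : exists2 v : 'cV[R[i]]_d.+1, v != 0 & Mc *m v = z *: v.
Proof.
have : eigenvalue Mc^T z by rewrite eigenvalue_root_char char_poly_trmx leading_root.
move=> /eigenvalueP[u uE u0]; exists u^T; last by rewrite -[Mc]trmxK -trmx_mul uE linearZ.
by apply: contra u0 => /eqP/(congr1 trmx); rewrite trmxK trmx0 => ->.
Qed.

Lemma leading_eigenvector_unique v w : v != 0 -> Mc *m v = z *: v -> Mc *m w = z *: w ->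
  exists a, w = a *: v.
Proof.
move=> v0 vE wE.
have row_eigen (u : 'cV[R[i]]_d.+1) : Mc *m u = z *: u -> (u^T <= eigenspace Mc^T z)%MS.
  by move=> uE; apply/eigenspaceP; rewrite -trmx_mul uE linearZ.
have rk : (\rank (eigenspace Mc^T z) <= 1)%N.
  apply: leq_trans (rank_eigenspace_le_mup _ _) _.
  by rewrite char_poly_trmx; have [_ -> _] := lead.
have vT0 : v^T != 0 by apply: contra v0 => /eqP/(congr1 trmx); rewrite trmxK trmx0 => ->.
have sub : (eigenspace Mc^T z <= v^T)%MS.
  by rewrite -(geq_leqif (mxrank_leqif_sup (row_eigen v vE))) rank_rV vT0.
have /sub_rVP[a aE] := submx_trans (row_eigen w wE) sub.
by exists a; apply: trmx_inj; rewrite aE linearZ.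
Qed.

(* [(M - conj z) x] is an eigenvector for [z] with imaginary part [Im z * x]. *)
Definition leading_part x : 'cV[R[i]]_d.+1 := (Mc - (conjc z)%:M) *m toC x.

Lemma leading_partE x : map_mx (@complex.Im R) (leading_part x) = complex.Im z *: x.
Proof.
apply/matrixP => i j; rewrite /leading_part mulmxBl mul_scalar_mx.
rewrite -map_mxM !mxE /=; case: z => a b /=.
by ring.
Qed.

Lemma leading_part_eigen x : leading_quadratic *m x = 0 ->
  Mc *m leading_part x = z *: leading_part x.
Proof.
move=> Qx; apply/eqP; rewrite -subr_eq0 -mul_scalar_mx -mulmxBl /leading_part mulmxA.
by rewrite -complexify_quadratic /complexify -map_mxM Qx map_mx0.
Qed.

Lemma quadratic_kernel_plane v x : v != 0 -> Mc *m v = z *: v -> leading_quadratic *m x = 0 ->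
  x \in <<[:: map_mx (@complex.Re R) v; map_mx (@complex.Im R) v]>>%VS.
Proof.
move=> v0 vE Qx.
have [[a b] aE] := leading_eigenvector_unique v0 vE (leading_part_eigen Qx).
(* The leading part of [x] equals [(a + ib) v]; its imaginary part is [Im z * x] on one side and
   [b Re v + a Im v] on the other. *)
have -> : x = (b / complex.Im z) *: map_mx (@complex.Re R) v +
    (a / complex.Im z) *: map_mx (@complex.Im R) v.
  apply: (scalerI nonreal); rewrite -leading_partE aE.
  apply/matrixP => i j; rewrite !mxE; case: (v i j) => p q /=; field; exact: nonreal.
by rewrite rpredD// rpredZ// memv_span// !in_cons eqxx ?orbT.
Qed.

Lemma real_imag_eq0 (a b : 'cV[R]_d.+1) : toC a + 'i%C *: toC b = 0 -> a = 0 /\ b = 0.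
Proof.
move=> /matrixP ab; have part i j : a i j = 0 /\ b i j = 0.
  have /eqP := ab i j; rewrite !mxE eq_complex /= => /andP[/eqP re /eqP im].
  by split; [rewrite -re|rewrite -im]; ring.
by split; apply/matrixP => i j; rewrite !mxE; have [] := part i j.
Qed.

Lemma quadratic_kernel_neq0 : exists2 x : 'cV[R]_d.+1, x != 0 & leading_quadratic *m x = 0.
Proof.
have [v v0 vE] := leading_eigenvector.
have Qv : complexify leading_quadratic *m v = 0.
  rewrite complexify_quadratic -mulmxA [_ *m v]mulmxBl vE mul_scalar_mx -scalerBl.
  by rewrite -scalemxAr mulmxBl vE mul_scalar_mx subrr scaler0.
have split_eq : complexify leading_quadratic *m v =
  toC (leading_quadratic *m map_mx (@complex.Re R) v) +
  'i%C *: toC (leading_quadratic *m map_mx (@complex.Im R) v).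
  rewrite !map_mxM scalemxAr -mulmxDr; congr (_ *m _); apply/matrixP => i j.
  by rewrite !mxE [LHS]complexE.
have parts : leading_quadratic *m map_mx (@complex.Re R) v = 0 /\
             leading_quadratic *m map_mx (@complex.Im R) v = 0.
  exact/real_imag_eq0/(etrans (esym split_eq)).
have [re0|re0] := eqVneq (map_mx (@complex.Re R) v) 0; last first.
  by exists (map_mx (@complex.Re R) v) => //; exact: parts.1.
exists (map_mx (@complex.Im R) v); last exact: parts.2.
apply: contra v0 => /eqP im0; apply/eqP/matrixP => i j.
move/matrixP/(_ i j): re0; move/matrixP/(_ i j): im0; rewrite !mxE.
by case: (v i j) => p q /= -> ->.
Qed.

(** [M] multiplies [leading_part x] by [z], hence [M ^+ N] multiplies it by a real number; imaginary
    parts carry this back to [x]. *)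
Lemma quadratic_kernel_power x N : z ^+ N = (cmod z ^+ N)%:C%C ->
  leading_quadratic *m x = 0 -> M ^+ N *m x = cmod z ^+ N *: x.
Proof.
move=> zN Qx; apply: (scalerI nonreal).
have pw k : Mc ^+ k *m leading_part x = z ^+ k *: leading_part x.
  elim: k => [|k IH]; first by rewrite expr0 scale1r mul1mx.
  by rewrite exprS -[_ * _]/(_ *m _) -mulmxA IH -scalemxAr leading_part_eigen// scalerA
    mulrC -exprS.
have : leading_part (M ^+ N *m x) = Mc ^+ N *m leading_part x.
  rewrite /leading_part map_mxM /= !mulmxA; congr (_ *m _).
  rewrite /complexify rmorphXn /= -/(complexify M).
  apply: (@GRing.commrX _ _ Mc N); rewrite /GRing.comm -[LHS]/(_ *m _) -[RHS]/(_ *m _).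
  by rewrite mulmxBl mulmxBr scalar_mxC.
rewrite pw zN -leading_partE => ->; rewrite scalerA mulrC -scalerA -leading_partE.
by apply/matrixP => i j; rewrite !mxE mulrC Im_mul_real mulrC.
Qed.

End LeadingEigenvalue.

Lemma rational_arg_power (R : realType) (z : R[i]) : rational_arg z ->
  exists2 N, (0 < N)%N & z ^+ N = (cmod z ^+ N)%:C%C.
Proof.
move=> [phi [q [zE phiE]]].
have pw n : z ^+ n = Complex (cmod z ^+ n * cos (phi *+ n)) (cmod z ^+ n * sin (phi *+ n)).
  elim: n => [|n IH]; first by rewrite !expr0 mulr0n cos0 sin0 mulr1 mulr0.
  rewrite exprS IH {1}zE exprS mulrS cosD sinD.
  by apply/eqP; rewrite eq_complex /=; apply/andP; split; apply/eqP; ring.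
have cos_nat k : cos (pi *+ (2 * k)) = 1 :> R /\ sin (pi *+ (2 * k)) = 0 :> R.
  have := sinpi R; have := cospi R; move: (pi : R) => p cp sp.
  elim: k => [|k [IHc IHs]]; first by rewrite muln0 mulr0n cos0 sin0.
  rewrite (_ : p *+ (2 * k.+1) = p *+ (2 * k) + p + p); last by rewrite mulnS !mulrSr.
  by rewrite !cosD !sinD IHc IHs sp cp; split; ring.
have piN0 : pi != 0 :> R by rewrite gt_eqF// pi_gt0.
have dq := denq_neq0 q.
have phiN : phi *+ (2 * `|denq q|) = pi *~ (2 * numq q).
  rewrite pmulrn PoszM absz_denq -[LHS]mulrzr -[RHS]mulrzr -[phi](divfK piN0) phiE.
  rewrite /ratr !intrM; have dR : (denq q)%:~R != 0 :> R by rewrite intr_eq0.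
  by field.
(* The denominator makes the argument a multiple of [pi]; the factor 2 makes it one of [2 pi], so
   that the power is positive. *)
exists (2 * `|denq q|)%N; first by rewrite muln_gt0 absz_gt0 denq_neq0.
rewrite pw phiN.
have [c1 s0] : cos (pi *~ (2 * numq q)) = 1 :> R /\ sin (pi *~ (2 * numq q)) = 0 :> R.
  case: (numq q) => n; first exact: (cos_nat n).
  by rewrite NegzE mulrN mulrNz cosN sinN (cos_nat n.+1).1 (cos_nat n.+1).2 oppr0.
by rewrite c1 s0 mulr1 mulr0.
Qed.

(** * Dominant products *)

(** The norm of [Q *m y] attains its minimum on the compact fibre of [F] over [x], and this minimum
    is below every positive [e]. *)
Lemma compact_fibre_limit (R : realType) d p q (G : set 'cV[R]_d)
    (Q : 'M[R]_(p, d)) (F : 'M[R]_(q, d))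
    (x : 'cV[R]_q) : compact G ->
  (forall e : R, 0 < e -> exists2 y, G y & `|Q *m y| <= e /\ F *m y = x) ->
  exists2 y, G y & Q *m y = 0 /\ F *m y = x.
Proof.
move=> cG H.
have cH := compact_closedI cG (closed_mulmx_fibre (A := F) (b := x)).
have cont : continuous (fun y : 'cV[R]_d => `|Q *m y|).
  move=> y; apply: (@continuous_comp _ _ _ (fun y => Q *m y) (fun u => `|u|)).
    exact: mulmx_continuous.
  exact: norm_continuous.
have [y0 Gy0 [_ Fy0]] := H 1 ltr01.
have [|y] := compact_EVT_min _ cH (continuous_subspaceT cont).
  by exists y0; split.
rewrite inE => -[Gy Fy] ymin; exists y => //; split => //.
apply/eqP; rewrite -normr_le0; apply/ler_addgt0Pr => e e0; rewrite add0r.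
have [y1 Gy1 [Q1 F1]] := H e e0.
by apply: le_trans Q1; apply: ymin; rewrite inE; split.
Qed.

Section Dominance.
Variables (R : realType) (d m : nat) (A : 'I_m -> 'M[R]_d) (s : seq 'I_m).
Hypothesis dom_s : unique_dominant_product A s.

Lemma dominant_neq_nil : s <> [::].
Proof. by have [nn _ _ _] := dom_s; exact: nn. Qed.

Lemma dominant_size_gt0 : (0 < size s)%N.
Proof. by rewrite lt0n size_eq0; apply/eqP; exact: dominant_neq_nil. Qed.

Lemma powR_invn_exprn (x : R) n : 0 <= x -> (0 < n)%N -> (x `^ (n%:R^-1)) ^+ n = x.
Proof.
move=> x0 n0; rewrite -powR_mulrn ?powR_ge0// -powRrM mulVf ?powRr1//.
by rewrite pnatr_eq0 -lt0n.
Qed.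

Lemma nu_ge0 w : 0 <= nu A w.
Proof. exact: powR_ge0. Qed.

Lemma nu_exprn w : w <> [::] -> nu A w ^+ size w = spectral_radius (word_prod A w).
Proof.
move=> w0; rewrite powR_invn_exprn ?spectral_radius_ge0//.
by rewrite lt0n size_eq0; apply/eqP.
Qed.

Lemma dominance_gap : exists2 e : R, 0 < e <= 1 & forall w, w <> [::] ->
  spectral_radius (word_prod A w) <= (1 - e) * nu A s ^+ size w \/
  exists j k, w = wpow (rot j s) k.
Proof.
have [_ _ _ [q [qE [e [/andP[e0 e1] gap]]]]] := dom_s.
exists e; first by rewrite e0 ltW.
move=> w w0; have [le|[p [u [k [-> [j ->] wE]]]]] := gap w w0; last by right; exists j, k.
left; have w1 : (0 < size w)%N by rewrite lt0n size_eq0; apply/eqP.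
rewrite -nu_exprn// (qE s)// -(@powR_invn_exprn (1 - e) (size w))//; last by lra.
by rewrite -exprMn lerXn2r ?nnegrE ?nu_ge0// mulr_ge0 ?powR_ge0// -(qE s)// nu_ge0.
Qed.

(** Scaling by a larger [r] only shrinks the eigenvalues. This covers both [|rho|], before it is
    known to equal [nu A s], and [nu A s] itself. *)
Lemma scaled_gap (r : R) : 0 < nu A s <= r -> exists2 e : R, 0 < e & forall w, w <> [::] ->
  (forall z, eigenvalue (complexify (word_prod (fun i => r^-1 *: A i) w)) z -> cmod z <= 1 - e) \/
  exists j k, w = wpow (rot j s) k.
Proof.
move=> /andP[nu0 nur]; have [e /andP[e0 e1] gap] := dominance_gap.
exists e => // w w0; have [le|?] := gap w w0; [left|by right].
have r0 : 0 < r by exact: lt_le_trans nur.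
move=> z; rewrite word_prod_scale => /eigenvalue_scale.
rewrite expf_neq0 ?invr_eq0 ?gt_eqF// => /(_ isT)/eigenvalue_le_radius.
rewrite cmodM cmodV cmod_real ger0_norm ?exprn_ge0 ?invr_ge0 ?(ltW r0)// exprVn invrK => H.
have rw : 0 < r ^+ size w by rewrite exprn_gt0.
rewrite -(ler_pM2r rw) (le_trans H)// (le_trans le)// ler_wpM2l ?subr_ge0//.
by rewrite lerXn2r ?nnegrE// ltW.
Qed.

End Dominance.

(** * Recurrent points come from the leading plane *)

Section Fibres.
Variables (R : realType) (d m : nat) (A : 'I_m -> 'M[R]_d.+1) (s : seq 'I_m) (z : R[i]).
Variables (G : set 'cV[R]_d.+1) (r : R).
Hypothesis bodyG : symmetric_convex_body G.
Hypothesis lead : unique_simple_leading_eigenvalue (word_prod A s) z.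
Hypothesis nonreal : complex.Im z != 0.
Hypothesis r0 : 0 < r.
Hypothesis zr : cmod z <= r ^+ size s.

Local Notation B := (fun i => r^-1 *: A i).
Local Notation M := (word_prod A s).
Local Notation Q := (leading_quadratic M z).
Hypothesis BG : forall i, forall x, G x -> G (B i *m x).

Lemma word_prod_rot_wpow (j : 'I_(size s)) k :
  word_prod B (wpow (rot j s) k.+1) =
  word_prod B (take j s) *m word_prod B s ^+ k *m word_prod B (drop j s).
Proof.
have wS w : wpow w k.+1 = wpow w k ++ w.
  by have := wpow_rot w [::] k; rewrite cats0 cat0s => ->.
rewrite wS {2}/rot catA wpow_rot cat_take_drop !word_prod_cat word_prod_wpow.
by rewrite -mulmxA.
Qed.

Lemma word_prod_power k : word_prod B s ^+ k = (r ^+ (size s * k))^-1 *: M ^+ k.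
Proof. by rewrite word_prod_scale exprZn exprVn exprVn exprM. Qed.

Lemma quadratic_power_small (e : R) : 0 < e -> exists K, forall k y, (K <= k)%N -> G y ->
  `|Q *m (word_prod B s ^+ k *m y)| <= e.
Proof.
move=> e0; have [C C0 GC] := body_bounded bodyG.
have D0 : 0 < d.+1%:R * C :> R by rewrite mulr_gt0.
have [K KP] := quadratic_decay lead nonreal (divr_gt0 e0 D0).
exists K => k y Kk Gy.
have comm : Q *m M ^+ k = M ^+ k *m Q by apply: (@GRing.commrX _ Q M k); exact: quadratic_comm.
rewrite word_prod_power -scalemxAl -scalemxAr normrZ mulmxA comm.
have rk : 0 < r ^+ (size s * k) by rewrite exprn_gt0.
rewrite ger0_norm ?invr_ge0 ?(ltW rk)// ler_pdivrMl//.
rewrite (le_trans (norm_mulmx_le _ _))//.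
apply: (@le_trans _ _ (d.+1%:R * (e / (d.+1%:R * C) * cmod z ^+ k) * C)).
  by rewrite ler_pM ?mulr_ge0// ?GC// ler_wpM2l// KP.
have -> : d.+1%:R * (e / (d.+1%:R * C) * cmod z ^+ k) * C = e * cmod z ^+ k.
  by field; rewrite gt_eqF//= ?pnatr_eq0.
by rewrite mulrC ler_wpM2r ?(ltW e0)// exprM lerXn2r ?nnegrE ?cmod_ge0// exprn_ge0 ?ltW.
Qed.

(** Arbitrarily many periods lead to [x]; most of them push the starting point towards the kernel of
    [Q], the last [L] periods and the partial word stay in a fixed matrix, and compactness gives a
    limit in the kernel. *)
Lemma recurrent_fibre (x : 'cV[R]_d.+1) (j : 'I_(size s)) L :
  (forall N, exists2 k, (N <= k)%N &
      exists2 y : 'cV[R]_d.+1, G y & x = word_prod B (wpow (rot j s) k) *m y) ->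
  exists2 y : 'cV[R]_d.+1, G y &
    Q *m y = 0 /\ word_prod B (take j s) *m word_prod B s ^+ L *m y = x.
Proof.
move=> rec; apply: compact_fibre_limit (body_compact bodyG) _ => e e0.
have [K KP] := quadratic_power_small e0.
have [[|k] Kk [y Gy xE]] := rec (K + L).+1; first by [].
have Gy' := word_prod_sub BG (drop j s) Gy.
exists (word_prod B s ^+ (k - L) *m (word_prod B (drop j s) *m y)).
  by rewrite -word_prod_wpow; exact: word_prod_sub.
split; first by apply: KP => //; lia.
rewrite xE word_prod_rot_wpow -!mulmxA [word_prod B s ^+ L *m _]mulmxA.
by rewrite -[_ ^+ L *m _]/(_ * _) -exprD subnKC//; lia.
Qed.

Lemma kernel_power (y : 'cV[R]_d.+1) N : z ^+ N = (cmod z ^+ N)%:C%C -> Q *m y = 0 ->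
  word_prod B s ^+ N *m y = (cmod z / r ^+ size s) ^+ N *: y.
Proof.
move=> zN Qy; rewrite word_prod_power -scalemxAl (quadratic_kernel_power nonreal zN Qy).
by rewrite scalerA expr_div_n mulrC exprM.
Qed.

End Fibres.

(** * Exploration of the nodes *)

Section PeriodicWords.
Variables (m : nat) (s : seq 'I_m) (i0 : 'I_m).
Hypothesis s0 : (0 < size s)%N.
Implicit Types (f w u : seq 'I_m).

Lemma nth_wpow u k i : (0 < size u)%N -> (i < k * size u)%N ->
  nth i0 (wpow u k) i = nth i0 u (i %% size u).
Proof.
move=> u0; elim: k i => [|k IH] i; first by rewrite mul0n.
rewrite wpowS nth_cat mulSn => ik; have [iu|ui] := ltnP i (size u).
  by rewrite modn_small.
by rewrite IH; [rewrite -{2}(subnK ui) modnDr|lia].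
Qed.

Lemma nth_rot j i : (j <= size s)%N -> (i < size s)%N ->
  nth i0 (rot j s) i = nth i0 s ((j + i) %% size s).
Proof.
move=> js is_; rewrite /rot nth_cat size_drop.
have [lt|ge] := ltnP i (size s - j).
  by rewrite nth_drop modn_small//; lia.
rewrite nth_take; last by lia.
have -> : (j + i = (i - (size s - j)) + size s)%N by lia.
by rewrite modnDr modn_small//; lia.
Qed.

Definition periodic_from j f : Prop :=
  forall i, (i < size f)%N -> nth i0 f i = nth i0 s ((j + i) %% size s).

Definition periodic_word f : Prop := exists j, periodic_from j f.

Lemma periodic_word_take l f : periodic_word f -> periodic_word (take l f).
Proof.
move=> [j jP]; exists j => i; rewrite size_take_min ltn_min => /andP[il jf].
by rewrite nth_take// jP.
Qed.

Lemma periodic_from_wpow j k : (j <= size s)%N -> periodic_from j (wpow (rot j s) k).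
Proof.
move=> js i; rewrite size_wpow size_rot => ik.
by rewrite nth_wpow ?size_rot// nth_rot ?ltn_mod// modnDmr.
Qed.

Lemma wpow_rot_periodic j k : periodic_word (wpow (rot j s) k).
Proof.
have [js|sj] := leqP j (size s); first by exists j; exact: periodic_from_wpow.
by exists 0%N; rewrite rot_oversize ?(ltnW sj)// -[s in wpow s]rot0; exact: periodic_from_wpow.
Qed.

Lemma size_path_word j t : size (take t (wpow (rot j s) t)) = t.
Proof. by rewrite size_takel// size_wpow size_rot; exact: leq_pmulr. Qed.

Lemma periodic_from_path j f : (j <= size s)%N -> periodic_from j f ->
  f = take (size f) (wpow (rot j s) (size f)).
Proof.
move=> js fP; apply: (@eq_from_nth _ i0) => [|i lt]; first by rewrite size_path_word.
rewrite fP// nth_take// (periodic_from_wpow js) ?size_wpow ?size_rot//.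
by apply: leq_trans lt _; exact: leq_pmulr.
Qed.

Lemma periodic_from_drop j g f : periodic_from j f -> periodic_from (j + g) (drop g f).
Proof.
move=> fP i; rewrite size_drop => lt; rewrite nth_drop fP ?addnA//; lia.
Qed.

Lemma periodic_from_mod j j' f : j = j' %[mod size s] -> periodic_from j f -> periodic_from j' f.
Proof. by move=> jj fP i /fP ->; rewrite -modnDml jj modnDml. Qed.

(** Dropping less than one period aligns the word with the phase of the root element [j], so that
    the rest runs along an infinite path of step (b). *)
Lemma periodic_word_phase (j : 'I_(size s)) f : periodic_word f ->
  exists2 g, (g < size s)%N & drop g f = take (size (drop g f)) (wpow (rot j s) (size (drop g f))).
Proof.
(* This is [j - r] modulo [size s], written without truncated subtraction. *)
move=> [r rP]; exists ((j + (size s - r %% size s)) %% size s)%N; first by rewrite ltn_mod.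
apply: periodic_from_path; first by rewrite ltnW.
refine (periodic_from_mod _ (periodic_from_drop (f := f) rP)).
rewrite modnDmr -modnDml addnCA subnKC ?modnDr//.
by rewrite ltnW// ltn_mod.
Qed.

End PeriodicWords.

Section Exploration.
Variables (R : realType) (d m : nat) (A : 'I_m -> 'M[R]_d) (s : seq 'I_m).
Variables (V1 G : set 'cV[R]_d) (i0 : 'I_m).
Local Notation B := (normalized A s).
Implicit Types (v u : node s) (w f : seq 'I_m) (C : set (node s)).

Hypothesis s0 : (0 < size s)%N.
Hypothesis bodyG : symmetric_convex_body G.
Hypothesis BG : forall i, forall x, G x -> G (B i *m x).
Hypothesis V1G : V1 `<=` G.
Hypothesis V1s : [set word_prod B s *m x | x in V1] = V1.

Definition first_letter v : 'I_m := tnth (in_tuple s) v.1.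

Lemma first_letterE v : first_letter v = nth i0 s v.1.
Proof. exact: tnth_nth. Qed.

Lemma extend_cat v w f : extend (extend v w) f = extend v (w ++ f).
Proof. by rewrite /extend /= catA. Qed.

Lemma node_set_extend v w :
  node_set A V1 (extend v w) = [set word_prod B w *m x | x in node_set A V1 v].
Proof.
rewrite /node_set image_comp; apply: eq_imagel => x _ /=.
by rewrite catA word_prod_cat mulmxA.
Qed.

Lemma node_set_sub v : node_set A V1 v `<=` G.
Proof. by move=> _ [x Vx <-]; apply: word_prod_sub => //; exact: V1G. Qed.

Lemma body_sub C : body A V1 C `<=` G.
Proof.
have [cG _ _ _] := bodyG.
apply: closed_convex_hull_min cG (body_closed bodyG) _.
by move=> x [v _]; exact: node_set_sub.
Qed.

(* Words starting with the first letter of their cyclic permutation are never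
   visited: they give the same sets as words over the next root element. *)
Definition canonical_node v : Prop :=
  if v.2 is a :: _ then a <> first_letter v else True.

Lemma canonical_root v : v.2 = [::] -> canonical_node v.
Proof. by rewrite /canonical_node => ->. Qed.

Lemma canonical_extend v w : v.2 <> [::] -> canonical_node v -> canonical_node (extend v w).
Proof. by case: v => j [|a l]. Qed.

(** A first letter that continues the cycle moves the node to the next root element; after the last
    one, [V1s] leads back to the first. *)
Lemma canonical_node_exists v :
  exists2 u, canonical_node u & node_set A V1 u = node_set A V1 v.
Proof.
case: v => j w; elim: w j => [|a w IH] j; first by exists (j, [::]).
have [aj|aj] := eqVneq a (tnth (in_tuple s) j); last first.
  by exists (j, a :: w) => //; exact/eqP.
have takeE : take j.+1 s = rcons (take j s) a.
  by rewrite (take_nth i0)// aj (tnth_nth i0).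
have [js|sj] := ltnP j.+1 (size s).
  have [u cu uE] := IH (Ordinal js); exists u => //; rewrite uE.
  by rewrite /node_set /= takeE cat_rcons.
have [u cu uE] := IH (Ordinal s0); exists u => //; rewrite uE /node_set /= take0 cat0s.
rewrite -cat_rcons -takeE take_oversize// -{1}V1s image_comp.
by apply: eq_imagel => x _ /=; rewrite word_prod_cat mulmxA.
Qed.

(** Measured against the final body [G] and not the current one, so independent of the iteration. *)
Definition boundary_node v : Prop := ~ (node_set A V1 v `<=` G°).

(** Words map interior points to interior points, so every ancestor of a boundary node is a boundary
    node. *)
Lemma boundary_node_prefix v w : boundary_node (extend v w) -> boundary_node v.
Proof.
apply: contra_not => sub; rewrite node_set_extend => _ [x /sub ix <-].
exact: word_prod_interior.
Qed.

Lemma boundary_not_body v C : boundary_node v -> ~ (node_set A V1 v `<=` (body A V1 C)°).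
Proof.
by apply: contra_not => sub x /sub; apply: filterS; exact: body_sub.
Qed.

Lemma path_word_prefix (j t t' : nat) : (t' <= t)%N ->
  take t' (wpow (rot j s) t') = take t' (wpow (rot j s) t).
Proof.
move=> t't; have -> : wpow (rot j s) t = wpow (rot j s) t' ++ wpow (rot j s) (t - t').
  by rewrite /wpow -flatten_cat -nseqD subnKC.
by rewrite takel_cat// size_wpow size_rot leq_pmulr.
Qed.

Lemma path_node_prefix v t t' : (t' <= t)%N -> exists w, path_node v t = extend (path_node v t') w.
Proof.
move=> t't; exists (drop t' (take t (wpow (rot v.1 s) t))).
rewrite /path_node extend_cat (path_word_prefix _ t't); congr extend.
by rewrite -{1}(cat_take_drop t' (take t _)) take_takel.
Qed.

Variable e : nat -> nat -> node s.
Hypothesis e_bij : forall k, bijective (e k).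
Local Notation V k := (state A V1 e k).1.
Local Notation H k := (state A V1 e k).2.

Lemma stateS k : state A V1 e k.+1 =
  let V' := \bigcup_i sweep A V1 k.+1 (V k) (H k) (e k.+1) i in (V', V' `\` V k).
Proof. by rewrite /=; case: (state A V1 e k). Qed.

Lemma state_mono1 k : V k `<=` V k.+1.
Proof. by rewrite stateS /= => v Vv; exists 0%N. Qed.

Lemma state_mono k l : (k <= l)%N -> V k `<=` V l.
Proof.
move=> /subnKC <-; elim: (l - k)%N => [|i IH]; first by rewrite addn0.
by rewrite addnS; apply: subset_trans IH _; exact: state_mono1.
Qed.

Lemma root_in_state k v : v.2 = [::] -> V k v.
Proof. by move=> v0; apply: (@state_mono 0%N k). Qed.

(** Locates the iteration at which [v] appeared; it is processed in the following one. Iteration 0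
    yields only root elements, so step (b) is in force for all other nodes. *)
Lemma state_birth k v : V k v -> exists2 l, (l <= k)%N & H l v /\ (l = 0%N -> v.2 = [::]).
Proof.
elim: k => [|k IH] Vv; first by exists 0%N.
have [/IH[l lk Hl]|nV] := pselect (V k v); first by exists l => //; exact: leqW.
by exists k.+1 => //; split=> //; rewrite stateS /=; split=> //; rewrite stateS in Vv.
Qed.

Lemma sweep_mono k W K (f : nat -> node s) i : W `<=` sweep A V1 k W K f i.
Proof.
elim: i => [//|i IH] v Wv /=; case: asboolP => _; last exact: IH.
by rewrite /process; case: ifP => _; [left; left|left]; exact: IH.
Qed.

Lemma state_process k v : H k v -> exists2 C, V k `<=` C &
  process A V1 k.+1 (V k) v C `<=` V k.+1.
Proof.
move=> Hv; have [g _ gK] := e_bij k.+1.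
exists (sweep A V1 k.+1 (V k) (H k) (e k.+1) (g v)); first exact: sweep_mono.
rewrite stateS => u uP; exists (g v).+1 => //=; rewrite gK.
by case: asboolP.
Qed.

(** Step (a) handles a letter leaving the cycle, the first node of the path in step (b) a letter
    following it. Step (b) is omitted in the first iteration, so from the root only the former is
    allowed. *)
Lemma state_letter k v a : V k v -> (v.2 <> [::] \/ a <> first_letter v) ->
  boundary_node (extend v [:: a]) -> V k.+1 (extend v [:: a]).
Proof.
move=> /state_birth[l lk [Hl l0]] va bd.
have [C VC sub] := state_process Hl.
apply: (@state_mono l.+1) => //; apply: sub.
have [aE|aE] := eqVneq a (first_letter v); last first.
  have H1 : (C `|` step_a A V1 (body A V1 (V l)) v) (extend v [:: a]).
    right; exists a; split => //; [exact/eqP|exact: boundary_not_body].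
  by rewrite /process; case: ifP => _ //; left.
have v0 : v.2 <> [::] by case: va => //; rewrite aE.
have l1 : (1 < l.+1)%N by case: l l0 {lk Hl C VC} => [/(_ erefl)|].
rewrite /process l1; right; exists 1%N.
have pE : path_node v 1 = extend v [:: a].
  rewrite /path_node; congr extend.
  apply: (@eq_from_nth _ i0); rewrite size_path_word// => -[|//] _.
  rewrite nth_take// (periodic_from_wpow i0 s0) ?size_wpow ?size_rot ?mul1n//; last exact: ltnW.
  by rewrite addn0 modn_small// aE first_letterE.
split => // t'; case: t' => [|[|]]// _; rewrite pE; exact: boundary_not_body.
Qed.

(** All earlier nodes of the path are boundary nodes as well, so none of them truncates the path,
    and one iteration reaches any depth. *)
Lemma state_path k v t : V k v -> v.2 <> [::] -> boundary_node (path_node v t) ->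
  V k.+1 (path_node v t).
Proof.
move=> Vv v0 bd; case: t bd => [|t] bd.
  by rewrite /path_node take0 /extend cats0; case: v Vv {v0 bd} => j w /state_mono1.
have [l lk [Hl l0]] := state_birth Vv.
have [C VC sub] := state_process Hl.
apply: (@state_mono l.+1) => //; apply: sub.
have l1 : (1 < l.+1)%N by case: l l0 {lk Hl C VC} => [/(_ erefl)|].
rewrite /process l1; right; exists t.+1; split => // t' /andP[_ t't].
apply: boundary_not_body; have [w wE] := path_node_prefix v t't.
by apply: (@boundary_node_prefix _ w); rewrite -wE.
Qed.

Lemma state_letters k v w : V k v -> v.2 <> [::] -> boundary_node (extend v w) ->
  V (k + size w) (extend v w).
Proof.
move=> Vv v0; elim/last_ind: w => [|w a IH] bd.
  by rewrite addn0 /extend cats0; case: v Vv {v0 bd}.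
rewrite -cats1 -extend_cat in bd *; rewrite size_cat addn1 addnS.
apply: state_letter => //; first exact/IH/(boundary_node_prefix bd).
by left; case: v v0 {Vv IH bd} => j [|].
Qed.

(** Fewer than [size s] single letters reach the phase of the root element; one further iteration
    covers the rest, whatever its length. *)
Lemma state_periodic k v f : V k v -> v.2 <> [::] -> periodic_word s i0 f ->
  boundary_node (extend v f) -> V (k + size s) (extend v f).
Proof.
move=> Vv v0 pf bd; have [g gs dropE] := periodic_word_phase s0 v.1 pf.
have fE : extend v f = path_node (extend v (take g f)) (size (drop g f)).
  by rewrite /path_node /= -dropE extend_cat cat_take_drop.
have bd' : boundary_node (extend v (take g f)).
  apply: (@boundary_node_prefix _ (drop g f)).
  by rewrite extend_cat cat_take_drop.
rewrite fE in bd *; apply: (@state_mono (k + size (take g f)).+1).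
  by rewrite -addnS leq_add2l size_take_min (leq_ltn_trans (geq_minl _ _) gs).
apply: state_path => //; first exact: state_letters.
by case: v v0 {Vv bd bd' fE dropE} => j [|].
Qed.

Lemma state_new k u : V k.+1 u -> ~ V k u -> exists v C, [/\ H k v, V k `<=` C &
  step_a A V1 (body A V1 (V k)) v u \/ (0 < k)%N /\ step_b A V1 (body A V1 C) v u].
Proof.
rewrite stateS /= => -[i _]; elim: i => [//|i IH] /=.
case: asboolP => [He|_]; last exact: IH.
have VC : V k `<=` sweep A V1 k.+1 (V k) (H k) (e k.+1) i by exact: sweep_mono.
move: VC IH; move: (sweep _ _ _ _ _ _ _) => C VC IH uP nVu.
have main : (C `|` step_a A V1 (body A V1 (V k)) (e k.+1 i)) u ->
  exists v C, [/\ H k v, V k `<=` C &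
  step_a A V1 (body A V1 (V k)) v u \/ (0 < k)%N /\ step_b A V1 (body A V1 C) v u].
  case=> [Cu|au]; first exact: IH.
  by exists (e k.+1 i), C; split=> //; left.
rewrite /process ltnS in uP; have [k0|k0] : (0 < k)%N \/ ~~ (0 < k)%N by exact/orP/orbN.
  2: by rewrite (negbTE k0) in uP; exact: main.
rewrite k0 in uP; case: uP => [/main//|bu].
exists (e k.+1 i), (C `|` step_a A V1 (body A V1 (V k)) (e k.+1 i)); split=> //.
  by move=> v /VC; left.
by right.
Qed.

Lemma state_canonical k v : V k v -> canonical_node v.
Proof.
elim: k v => [|k IH] u Vu; first exact: canonical_root.
have [/IH//|nVu] := pselect (V k u).
have [v [C [Hv VC [[a [av -> _]]|[k0 [t [t0 -> _]]]]]]] := state_new Vu nVu.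
  have [v0|/eqP v0] := eqVneq v.2 [::]; first by rewrite /canonical_node /= v0.
  apply: canonical_extend => //; apply: IH.
  by case: k Hv {Vu nVu VC} => [//|k]; rewrite stateS => -[].
(* Here [v] is new at a positive iteration, so it is not a root element and extending it keeps its
   first letter. *)
case: k k0 Hv {IH Vu nVu VC} (IH v) => // k _; rewrite stateS => -[Vv nVv] /(_ Vv) cv.
by apply: canonical_extend => // v0; apply: nVv; exact: root_in_state.
Qed.

Hypothesis return_word : exists2 delta : R, 0 < delta & forall w (x : 'cV[R]_d), w <> [::] ->
  ~ G° x -> `|word_prod B w *m x - x| < delta -> exists j k, w = wpow (rot j s) k.

(** A point of [V1] with non-interior final image has non-interior images all along the word, since
    an interior one would stay interior. *)
Lemma boundary_orbit v : boundary_node v -> exists x : nat -> 'cV[R]_d,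
  [/\ forall i, G (x i), forall i, ~ G° (x i) &
      forall i j, (i <= j)%N -> x j = word_prod B (drop i (take j v.2)) *m x i].
Proof.
move=> bd; have [p [Vp np]] : exists p, V1 p /\
    ~ G° (word_prod B (take v.1 s ++ v.2) *m p).
  apply: contrapT => /forallNP H; apply: bd => _ [p Vp <-].
  by apply: contrapT => np; apply: (H p).
pose x i := word_prod B (take v.1 s ++ take i v.2) *m p.
have xE i j : (i <= j)%N -> x j = word_prod B (drop i (take j v.2)) *m x i.
  move=> ij; rewrite /x mulmxA -word_prod_cat -catA; congr (word_prod B (_ ++ _) *m _).
  by rewrite -{1}(cat_take_drop i (take j v.2)) take_takel.
exists x; split; last exact: xE.
  by move=> i; apply: (word_prod_sub BG); exact: V1G.
move=> i ix; apply: np; rewrite -(cat_take_drop i v.2) catA word_prod_cat -mulmxA.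
exact: word_prod_interior.
Qed.

(* Cut [v.2] greedily at [b 0 < b 1 < ...] so that no [v.2[b i, b (i + 1))] is
   periodic. Two cuts whose points are close would enclose a power of a cyclic
   permutation of [s], so the number of cuts is bounded uniformly in [v]. *)
Lemma boundary_cuts v c : canonical_node v -> boundary_node v -> v.2 <> [::] ->
  V (1 + c * (size s).+1)%N v \/
  exists b : nat -> nat, [/\ (0 < b 0)%N, forall i, (i < c)%N -> (b i < b i.+1)%N,
    forall i, (i < c)%N -> ~ periodic_word s i0 (drop (b i) (take (b i.+1) v.2)),
    (b c <= size v.2)%N &
    V (1 + c * (size s).+1)%N (v.1, take (b c) v.2)].
Proof.
move=> cv bv v0; elim: c => [|c [Vv|[b [b0 bS bP bc Vb]]]].
(* The first letter is cut off separately: canonicity lets step (a) produce it from the root, and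
   step (b) serves only later nodes. *)
- right; exists (fun _ => 1%N); split => //; first by case: v.2 v0.
  have [a [w vE]] : exists a w, v.2 = a :: w by case: v.2 v0 => // a w; exists a, w.
  have H0 : V 0 (v.1, [::]) by [].
  have bd1 : boundary_node (extend (v.1, [::]) [:: a]).
    apply: (@boundary_node_prefix _ w); rewrite /extend /= -vE.
    by case: v bv {cv v0 vE H0}.
  have := state_letter H0 _ bd1; rewrite vE /extend /= take0; apply.
  by right; move: cv; rewrite /canonical_node vE.
- by left; apply: state_mono Vv; rewrite leq_add2l leq_mul2r leqnSn orbT.
pose r := drop (b c) v.2.
have vE : v = extend (v.1, take (b c) v.2) r.
  by rewrite /extend /= cat_take_drop; case: (v).
have t0 : take (b c) v.2 <> [::].
  move/(congr1 size); rewrite size_takel//=.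
  have : (0 < b c)%N; last by case: (b c).
  by elim: c {Vb bc r vE} bS {bP} => // c IHc bS; apply: leq_ltn_trans (bS c _).
(* A cut costs [size s] iterations for its periodic part and one for the letter that breaks the
   period. *)
have le : (1 + c * (size s).+1 + size s <= 1 + c.+1 * (size s).+1)%N by lia.
have [pr|npr] := pselect (periodic_word s i0 r).
  left; apply: (state_mono le); rewrite vE; apply: state_periodic => //.
  by rewrite -vE.
have ex : exists l, `[< ~ periodic_word s i0 (take l r) >].
  by exists (size r); apply/asboolP; rewrite take_size.
(* The next cut is the shortest non-periodic prefix of the remainder; without its last letter it is
   periodic. *)
have [l /asboolP nl lmin] := ex_minnP ex.
have lr : (l <= size r)%N.
  by apply: lmin; apply/asboolP; rewrite take_size.
have l0 : (0 < l)%N.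
  by case: l nl {lmin lr} => // /(_ _)[]; exists 0%N; rewrite take0.
have pl : periodic_word s i0 (take l.-1 r).
  apply: contrapT => npl; have := lmin l.-1; rewrite (asboolT npl) => /(_ isT).
  by rewrite leqNgt prednK// leqnn.
right; exists (fun i => if (i <= c)%N then b i else (b c + l)%N).
have bcl : (b c + l <= size v.2)%N.
  by move: lr; rewrite /r size_drop; lia.
split => //.
- move=> i ic1; have [->|ic] : i = c \/ (i < c)%N by lia.
    by rewrite /= leqnn ltnn -[X in (X < _)%N]addn0 ltn_add2l.
  by rewrite (ltnW ic) ic; exact: bS.
- move=> i ic1; have [->|ic] : i = c \/ (i < c)%N by lia.
  2: by rewrite (ltnW ic) ic; exact: bP.
  by rewrite /= leqnn ltnn addnC -take_drop.
- by rewrite ltnn.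
rewrite ltnn.
have rl : take l r = take l.-1 r ++ [:: nth i0 r l.-1].
  by rewrite cats1 -take_nth ?prednK//; lia.
have uE : (v.1, take (b c + l) v.2) =
    extend (extend (v.1, take (b c) v.2) (take l.-1 r)) [:: nth i0 r l.-1].
  rewrite extend_cat -rl /extend /= /r take_drop [(l + _)%N]addnC; congr pair.
  by rewrite -{1}(cat_take_drop (b c) (take (b c + l) v.2)) take_takel// leq_addr.
have bu : boundary_node (v.1, take (b c + l) v.2).
  apply: (@boundary_node_prefix _ (drop (b c + l) v.2)).
  by rewrite /extend /= cat_take_drop; case: (v) bv.
rewrite uE in bu *.
have -> : (1 + c.+1 * (size s).+1 = (1 + c * (size s).+1 + size s).+1)%N by lia.
apply: state_letter => //.
  apply: state_periodic => //; exact: boundary_node_prefix bu.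
by left; rewrite /extend /=; case: (take (b c) v.2) t0.
Qed.

Lemma boundary_visited : exists T, forall v, canonical_node v -> boundary_node v -> V T v.
Proof.
have [delta delta0 ret] := return_word.
have [N NP] := compact_close_pair (body_compact bodyG) delta0.
exists (1 + N * (size s).+1)%N => v cv bv.
have [v0|/eqP v0] := eqVneq v.2 [::]; first exact: root_in_state.
have [//|[b [b0 bS bP bN _]]] := boundary_cuts N cv bv v0.
exfalso; have [x [Gx nx xE]] := boundary_orbit bv.
have [i [j [/andP[ij jN] close]]] := NP (fun i => x (b i)) (fun i _ => Gx (b i)).
have mono k l : (k <= l <= N)%N -> (b k <= b l)%N.
  move=> /andP[/subnKC <-]; elim: (l - k)%N => [|a IH] kl; first by rewrite addn0.
  apply: leq_trans (IH _) _; first by lia.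
  by rewrite addnS; apply/ltnW/bS; lia.
have iN : (i < N)%N by exact: leq_trans ij jN.
have bij : (b i.+1 <= b j)%N by apply: mono; rewrite ij.
have bi : (b i < b i.+1)%N by exact: bS.
have bj : (b j <= size v.2)%N by apply: leq_trans bN; apply: mono; rewrite jN leqnn.
apply: (bP i iN).
(* The non-periodic piece begins the word between two close points, which is a power of a cyclic
   permutation of [s]: a contradiction. *)
have -> : drop (b i) (take (b i.+1) v.2) =
    take (b i.+1 - b i) (drop (b i) (take (b j) v.2)).
  by rewrite take_drop subnK ?(ltnW bi)// take_takel.
apply: periodic_word_take.
have [|||p [k ->]] := ret (drop (b i) (take (b j) v.2)) (x (b i)).
- by move/(congr1 size); rewrite size_drop size_takel//=; lia.
- exact: nx.
- by rewrite -xE; [rewrite distrC|lia].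
exact: wpow_rot_periodic.
Qed.

Hypothesis d0 : (0 < d)%N.
Hypothesis V1_neq0 : V1 !=set0.
Hypothesis extreme_node : forall x, extreme_point G x -> exists v, node_set A V1 v x.

(** If the body missed a point of [G], it would miss an extreme one by [extreme_outside]; but that
    point lies in a boundary node, whose canonical form belongs to [C]. *)
Lemma body_complete C : (forall v, canonical_node v -> boundary_node v -> C v) ->
  @root_set m s `<=` C -> body A V1 C = G.
Proof.
move=> bdC rC; apply/seteqP; split; first exact: body_sub.
move=> x Gx; apply: contrapT => nx.
have cK : compact (body A V1 C).
  apply: (subclosed_compact _ (body_compact bodyG)); last exact: body_sub.
  exact: closed_closure.
have nodeC v : C v -> node_set A V1 v `<=` body A V1 C.
  by move=> Cv y vy; apply: subset_closed_convex_hull; exists v.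
have K0 : body A V1 C !=set0.
  have [y Vy] := V1_neq0; pose v : node s := (Ordinal s0, [::]).
  exists (word_prod B (take v.1 s ++ v.2) *m y).
  by apply: (nodeC v); [exact: rC|exists y].
have [y exty nKy] := extreme_outside (body_compact bodyG) cK
  (@closed_convex_hull_convex _ _ _) K0 Gx nx.
have [v vy] := extreme_node exty; have [u cu uE] := canonical_node_exists v.
apply: nKy; apply: (nodeC u); last by rewrite uE.
apply: bdC => // sub; rewrite uE in sub.
exact: (extreme_not_interior (x := y) d0 exty (sub _ vy)).
Qed.

Lemma exploration_halts : exists k, halts_at A V1 e k /\ body A V1 (V k) = G.
Proof.
have [T TP] := boundary_visited.
have bodyT C : V T `<=` C -> body A V1 C = G.
  move=> TC; apply: body_complete => v; first by move=> cv bv; apply/TC/TP.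
  by move=> v0; apply/TC/root_in_state.
exists T.+1; split; last by apply: bodyT; exact: state_mono1.
split => //; apply/seteqP; split; last exact: state_mono1.
move=> u Vu; apply: contrapT => nVu; apply: (nVu).
apply: TP; first exact: state_canonical Vu.
(* Both tests compare with the body of a collection containing that of iteration [T], which is [G];
   so a new node would be a boundary node, already present. *)
have [v [C [_ TC [[a [_ -> out]]|[_ [t [t0 -> out]]]]]]] := state_new Vu nVu.
  by move: out; rewrite bodyT.
by rewrite /boundary_node -(bodyT C TC); apply: out; rewrite t0 leqnn.
Qed.

End Exploration.

(** * Invariant bodies *)

Section InvariantBody.
Variables (R : realType) (d m : nat) (A : 'I_m -> 'M[R]_d.+1) (s : seq 'I_m) (z : R[i]).
Variables (G : set 'cV[R]_d.+1) (rho : R).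
Hypothesis dom_s : unique_dominant_product A s.
Hypothesis lead : unique_simple_leading_eigenvalue (word_prod A s) z.
Hypothesis nonreal : complex.Im z != 0.
Hypothesis rat_z : rational_arg z.
Hypothesis bodyG : symmetric_convex_body G.
Hypothesis hullG : convex_hull (\bigcup_i [set A i *m x | x in G]) = [set rho *: x | x in G].

Local Notation M := (word_prod A s).
Local Notation Q := (leading_quadratic M z).
Local Notation q := (nu A s).
Local Notation V1 := [set x | G x /\ Q *m x = 0].

Lemma nu_cmod : q ^+ size s = cmod z.
Proof.
by rewrite (nu_exprn A (dominant_neq_nil dom_s)) (leading_radius (z := z))//; have [] := lead.
Qed.

Lemma nu_gt0 : 0 < q.
Proof.
rewrite lt_def nu_ge0 andbT; apply/eqP => q0; have := leading_cmod_gt0 nonreal.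
by rewrite -nu_cmod q0 expr0n gtn_eqF ?(dominant_size_gt0 dom_s)// ltxx.
Qed.

(** Stated without division, since [rho] is not yet known to be nonzero. *)
Lemma word_image w x : G x ->
  exists2 y, G y & word_prod A w *m x = `|rho| ^+ size w *: y.
Proof.
elim/last_ind: w x => [|w i IH] x Gx; first by exists x; rewrite // mul1mx expr0 scale1r.
have [y Gy yE] := IH x Gx; have [y' Gy' y'E] := hull_image bodyG hullG i Gy.
exists y' => //; rewrite -cats1 word_prod_cat word_prod1 -mulmxA yE -scalemxAr y'E.
by rewrite scalerA size_cat addn1 exprSr.
Qed.

Lemma kernel_point : exists x, [/\ x != 0, G x & Q *m x = 0].
Proof.
have [x x0 Qx] := quadratic_kernel_neq0 lead.
have [r r0 rG] := body_ball bodyG.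
have nx : 0 < `|x| by rewrite normr_gt0.
have t0 : 0 < r / 2 / `|x| by rewrite !divr_gt0.
exists ((r / 2 / `|x|) *: x); split.
- by rewrite scaler_eq0 negb_or x0 gt_eqF.
- by apply: rG; rewrite normrZ gtr0_norm// divfK ?gt_eqF//; lra.
- by rewrite -scalemxAr Qx scaler0.
Qed.

(** On a kernel point, suitable powers of [s] act as powers of [q], whereas images of [G] grow at
    most like powers of [|rho|]. *)
Lemma nu_le_norm : q <= `|rho|.
Proof.
rewrite leNgt; apply/negP => lt.
have [N N0 zN] := rational_arg_power rat_z.
have [x [x0 Gx Qx]] := kernel_point; have [C C0 GC] := body_bounded bodyG.
pose a := q ^+ (size s * N); pose b := `|rho| ^+ (size s * N).
have sN : (0 < size s * N)%N by rewrite muln_gt0 (dominant_size_gt0 dom_s).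
have a0 : 0 < a by exact/exprn_gt0/nu_gt0.
have ba : b / a < 1 by rewrite ltr_pdivrMr// mul1r ltr_pXn2r ?nnegrE ?nu_ge0.
have b0 : 0 <= b / a by rewrite divr_ge0 ?(ltW a0) ?exprn_ge0.
have nx : 0 < `|x| by rewrite normr_gt0.
have bound k : `|x| <= (b / a) ^+ k * C.
  have zNk : z ^+ (N * k) = (cmod z ^+ (N * k))%:C%C.
    by rewrite !exprM zN -rmorphXn.
  have [y Gy] := word_image (wpow s (N * k)) Gx.
  rewrite word_prod_wpow (quadratic_kernel_power nonreal zNk Qx) => E.
  have := congr1 (fun u => `|u|) E; rewrite !normrZ !normrX normr_id.
  rewrite ger0_norm ?cmod_ge0// size_wpow => E'.
  have cE : cmod z ^+ (N * k) = a ^+ k by rewrite -nu_cmod -!exprM mulnA.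
  have rE : `|rho| ^+ (N * k * size s) = b ^+ k by rewrite -!exprM mulnC mulnA.
  rewrite cE rE in E'.
  have ak : 0 < a ^+ k by rewrite exprn_gt0.
  rewrite expr_div_n mulrAC ler_pdivlMr// mulrC E' ler_wpM2l ?GC// exprn_ge0// exprn_ge0//.
(* With zero perturbation this is the convergence of the geometric sequence to 0, which contradicts
   [bound]. *)
have [|||||K KP] := @contracting_recurrence R (b / a) (fun k => (b / a) ^+ k) (fun _ => 0)
  _ _ _ _ (`|x| / 2 / C).
- by rewrite b0.
- by move=> k; exact: exprn_ge0.
- by move=> k; rewrite addr0 exprS.
- by move=> e e0; exists 0%N => _ _; exact: ltW.
- by rewrite !divr_gt0.
have := KP K (leqnn _); rewrite ler_pdivlMr// => h1; have h2 := bound K; lra.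
Qed.

Lemma norm_gt0 : 0 < `|rho|.
Proof. exact: lt_le_trans nu_gt0 nu_le_norm. Qed.

Lemma rho_neq0 : rho != 0.
Proof. by rewrite -normr_gt0 norm_gt0. Qed.

Lemma cmod_le_norm : cmod z <= `|rho| ^+ size s.
Proof. by rewrite -nu_cmod lerXn2r ?nnegrE ?nu_ge0// nu_le_norm. Qed.

Local Notation Br := (fun i => `|rho|^-1 *: A i).

Lemma scaled_sub i x : G x -> G (Br i *m x).
Proof. exact: (hull_scaled_image bodyG hullG rho_neq0). Qed.

Lemma extreme_fibre x0 L : extreme_point G x0 ->
  exists x w (j : 'I_(size s)) y, [/\ extreme_point G x, x0 = word_prod Br w *m x, V1 y &
    word_prod Br (take j s) *m word_prod Br s ^+ L *m y = x].
Proof.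
move=> ext0.
have [|e e0 gap] := scaled_gap dom_s (r := `|rho|); first by rewrite nu_gt0 nu_le_norm.
have [x [w [j [extx xE rec]]]] := extreme_orbit_tail bodyG scaled_sub e0 gap
  (hull_scaled_preimage bodyG hullG rho_neq0) (ltn0Sn d) (dominant_size_gt0 dom_s) ext0.
have [y Gy [Qy yE]] := recurrent_fibre bodyG lead nonreal norm_gt0 cmod_le_norm scaled_sub L rec.
by exists x, w, j, y.
Qed.

(** If [|rho|] were larger, [N] periods would shrink a kernel point by a factor [t < 1]; an extreme
    point would then be [t] times a point of [G], hence interior. *)
Lemma norm_nu : `|rho| = q.
Proof.
apply/eqP; rewrite eq_le nu_le_norm andbT leNgt; apply/negP => lt.
have [N N0 zN] := rational_arg_power rat_z.
have [x0 ext0 _] := farthest_extreme 0 (body_compact bodyG) (ex_intro _ 0 (body0 bodyG)).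
have [x [w [j [y [extx _ [Gy Qy] yE]]]]] := extreme_fibre N ext0.
apply: (extreme_not_interior (ltn0Sn d) extx).
pose t := (cmod z / `|rho| ^+ size s) ^+ N.
have rs : 0 < `|rho| ^+ size s by rewrite exprn_gt0// norm_gt0.
have t0 : 0 < t by rewrite exprn_gt0// divr_gt0// leading_cmod_gt0.
have t1 : t < 1.
  rewrite /t -(expr1n R N) ltr_pXn2r ?nnegrE ?divr_ge0 ?cmod_ge0 ?(ltW rs)//.
  by rewrite ltr_pdivrMr// mul1r -nu_cmod ltr_pXn2r ?nnegrE ?nu_ge0// (dominant_size_gt0 dom_s).
have xE : x = t *: (word_prod Br (take j s) *m y).
  rewrite -yE -mulmxA (kernel_power `|rho| nonreal zN Qy) -scalemxAr; by [].
apply/(body_interiorP bodyG); exists t^-1; first by rewrite invf_gt1.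
rewrite xE scalerA mulVf ?gt_eqF// scale1r.
exact: (word_prod_sub scaled_sub).
Qed.

Lemma normalizedE : normalized A s = Br.
Proof. by rewrite norm_nu. Qed.

Lemma kernel_body_period y : exists2 N, (0 < N)%N &
  (V1 y -> word_prod (normalized A s) s ^+ N *m y = y).
Proof.
have [N N0 zN] := rational_arg_power rat_z; exists N => // -[_ Qy].
rewrite normalizedE (kernel_power `|rho| nonreal zN Qy) norm_nu nu_cmod.
by rewrite divff ?expr1n ?scale1r// gt_eqF// leading_cmod_gt0.
Qed.

Lemma normalized_sub i x : G x -> G (normalized A s i *m x).
Proof. by rewrite normalizedE; exact: scaled_sub. Qed.

Lemma word_prod_leading : M = cmod z *: word_prod (normalized A s) s.
Proof.
rewrite word_prod_scale scalerA -nu_cmod exprVn divff ?scale1r//.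
by rewrite expf_neq0// gt_eqF// nu_gt0.
Qed.

Lemma kernel_body_stable x : V1 x -> V1 (word_prod (normalized A s) s *m x).
Proof.
move=> [Gx Qx]; split; first exact: (word_prod_sub normalized_sub).
rewrite word_prod_scale -scalemxAl -scalemxAr mulmxA quadratic_comm -mulmxA Qx.
by rewrite mulmx0 scaler0.
Qed.

(** The normalized product is periodic on the leading plane, so its inverse there is one of its own
    powers and preserves [V1]. *)
Lemma kernel_body_image : [set word_prod (normalized A s) s *m x | x in V1] = V1.
Proof.
apply/seteqP; split=> [_ [x Vx <-]|x Vx]; first exact: kernel_body_stable.
have [[//|N] _ xE] := kernel_body_period x.
exists (word_prod (normalized A s) s ^+ N *m x); last first.
  by rewrite mulmxA -[RHS](xE Vx) exprS.
elim: N {xE} => [|N IH]; first by rewrite expr0 mul1mx.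
by rewrite exprS -[_ * _]/(_ *m _) -mulmxA; exact: kernel_body_stable.
Qed.

Lemma kernel_body_admissible : admissible M z V1.
Proof.
have [v v0 vE] := leading_eigenvector lead.
split.
  exists <<[:: map_mx (@complex.Re R) v; map_mx (@complex.Im R) v]>>%VS; split; last first.
    by move=> x [_ Qx]; exact: (quadratic_kernel_plane lead nonreal v0 vE Qx).
  exists (map_mx (@complex.Re R) v), (map_mx (@complex.Im R) v).
  have -> : map_mx (real_complex R) (map_mx (@complex.Re R) v) +
    Complex 0 1 *: map_mx (real_complex R) (map_mx (@complex.Im R) v) = v.
    by apply/matrixP => i j; rewrite !mxE [RHS]complexE.
  by split.
split; split.
- by exists 0; split; [exact: body0|rewrite mulmx0].
- have [x [x0 Gx Qx]] := kernel_point => E.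
  have x00 : [set 0] x by rewrite -E; split.
  by move: x0; rewrite x00 eqxx.
- apply/convex_setP => x y t [Gx Qx] [Gy Qy] t01; split; first exact: body_convex.
  by rewrite mulmxDr -!scalemxAr Qx Qy !scaler0 addr0.
- exact: (compact_closedI (body_compact bodyG) (@closed_mulmx_fibre _ _ _ Q 0)).
- apply/seteqP; split=> [x [Gx Qx]|_ [x [Gx Qx] <-]].
    by exists (- x); [split; [exact: body_opp|rewrite mulmxN Qx oppr0]|rewrite opprK].
  by split; [exact: body_opp|rewrite mulmxN Qx oppr0].
- rewrite -{2}kernel_body_image image_comp; apply: eq_imagel => x _ /=.
  by rewrite {1}word_prod_leading scalemxAl.
Qed.

Lemma kernel_body_constructed : constructed_by_algorithm3 A s V1 G.
Proof.
move=> e e_bij; have s0 := dominant_size_gt0 dom_s.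
pose i0 := tnth (in_tuple s) (Ordinal s0).
have [|eps eps0 gap] := scaled_gap dom_s (r := q); first by rewrite nu_gt0 /=.
apply: (exploration_halts i0) => //.
- exact: normalized_sub.
- by move=> x [].
- exact: kernel_body_image.
- exact: (close_return bodyG normalized_sub eps0 gap).
- by exists 0; split; [exact: body0|rewrite mulmx0].
(* With [L = 0] the extreme point is the image under [w] of a point of the root element [j]. *)
move=> x0 ext0; have [x [w [j [y [_ x0E Vy yE]]]]] := extreme_fibre 0 ext0.
exists (j, w); exists y => //=.
by rewrite word_prod_cat normalizedE x0E -yE expr0 mulmx1 mulmxA.
Qed.

End InvariantBody.

Theorem theorem8 (R : realType) (d m : nat) (A : 'I_m -> 'M[R]_d)
    (s : seq 'I_m) (z : R[i]) (G : set 'cV[R]_d)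
    (irrA : irreducible_family A)
    (dom_s : unique_dominant_product A s)
    (lead_z : unique_simple_leading_eigenvalue (word_prod A s) z)
    (nonreal_z : complex.Im z != 0)
    (rat_z : rational_arg z)
    (inv_G : invariant_body A G) :
  exists V1 : set 'cV[R]_d,
    admissible (word_prod A s) z V1 /\ constructed_by_algorithm3 A s V1 G.
Proof.
case: d A G irrA dom_s lead_z inv_G => [|d] A G _ dom_s lead_z [bodyG hullG].
  (* In dimension 0 there is no nonzero eigenvector. *)
  have [[/eigenvalueP[v _ v0] _] _ _] := lead_z; move: v0.
  by rewrite [v]thinmx0 eqxx.
exists [set x | G x /\ leading_quadratic (word_prod A s) z *m x = 0]; split.
  exact: kernel_body_admissible hullG.
exact: kernel_body_constructed hullG.
Qed.
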